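(* Let $\mathcal{X}$ and $\mathcal{Y}$ be finite, let $c:\mathcal{X}\times\mathcal{Y}\to\mathbb{R}_+$ be a cost function, and let $\mu\in\mathcal{M}_s(\mathcal{X}^{\mathbb{N}})$ and $\nu\in\mathcal{M}_s(\mathcal{Y}^{\mathbb{N}})$ be ergodic. Let $X=X_1,X_2,\ldots$ and $Y=Y_1,Y_2,\ldots$ be processes with distributions $\mu$ and $\nu$, respectively. Then there exists a sequence $k=k(n)$ with $k(n)\to\infty$ such that, almost surely as $n\to\infty$, $\hat{S}_{k(n),n}\to S(\mu,\nu)$ and $\hat{\lambda}^{k(n),n}\Rightarrow\mathcal{J}_{\min}(\mu,\nu)$.
   Context: Spaces and measures: finite sets carry the discrete topology and sequence spaces the product topology. $\mathcal{M}(\mathcal{U})$ is the set of Borel probability measures on $\mathcal{U}$. $\mathcal{M}_s(\mathcal{U}^{\mathbb{N}})$ is the set of stationary measures, i.e. those invariant under the left shift $(u_1,u_2,\ldots)\mapsto(u_2,u_3,\ldots)$; $\mathcal{X}^{\mathbb{N}}\times\mathcal{Y}^{\mathbb{N}}$ is identified with $(\mathcal{X}\times\mathcal{Y})^{\mathbb{N}}$, so stationarity there is with respect to the joint left shift. A stationary measure is ergodic if every shift-invariant measurable set has measure 0 or 1. For a measure $\gamma$ on a sequence space, $\gamma_k$ is the distribution of the first $k$ coordinates. Couplings and joinings: $\Pi(\alpha,\beta)$ is the set of couplings of $\alpha$ and $\beta$. For a cost $d:\mathcal{U}\times\mathcal{V}\to\mathbb{R}_+$, $T_d(\alpha,\beta)=\inf_{\pi\in\Pi(\alpha,\beta)}\int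 d\,d\pi$. A joining of $\mu$ and $\nu$ is a stationary coupling; $\mathcal{J}(\mu,\nu)=\Pi(\mu,\nu)\cap\mathcal{M}_s(\mathcal{X}^{\mathbb{N}}\times\mathcal{Y}^{\mathbb{N}})$. The optimal joining cost is $S(\mu,\nu)=\inf_{\lambda\in\mathcal{J}(\mu,\nu)}\int c\,d\lambda_1$, and $\mathcal{J}_{\min}(\mu,\nu)$ is the set of joinings attaining this infimum. The $k$-step cost is $c_k(x_1^k,y_1^k)=\sum_{\ell=1}^k c(x_\ell,y_\ell)$. Estimators, for $1\le k\le n$: the $k$-block empirical measure is $\hat\mu_{k,n}(x_1^k)=\frac{1}{n-k+1}\sum_{\ell=0}^{n-k}\mathbb{1}(x_1^k=X_{\ell+1}^{\ell+k})$ for $x_1^k\in\mathcal{X}^k$, and $\hat\nu_{k,n}$ is defined in the same way from $Y_1^n$. Let $\pi_k\in\Pi(\hat\mu_{k,n},\hat\nu_{k,n})$ be any coupling minimizing $\int c_k\,d\pi$ over $\Pi(\hat\mu_{k,n},\hat\nu_{k,n})$. Set $\hat S_{k,n}=k^{-1}T_{c_k}(\hat\mu_{k,n},\hat\nu_{k,n})$ and $\hat\lambda^{k,n}=\Lambda^k[\pi_k]\in\mathcal{M}_s(\mathcal{X}^{\mathbb{N}}\times\mathcal{Y}^{\mathbb{N}})$, where for a finite set $\mathcal{U}$ and $\gamma\in\mathcal{M}(\mathcal{U}^k)$, $\tilde\Lambda^k[\gamma]\in\mathcal{M}(\mathcal{U}^{\mathbb{N}})$ is the measure under which consecutive non-overlapping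 $k$-blocks are i.i.d. with law $\gamma$, and $\Lambda^k[\gamma](A)=\frac1k\sum_{\ell=0}^{k-1}\tilde\Lambda^k[\gamma](\mathcal{U}^\ell\times A)$ for measurable $A\subset\mathcal{U}^{\mathbb{N}}$ (here $\mathcal{U}=\mathcal{X}\times\mathcal{Y}$ with $\mathcal{X}^k\times\mathcal{Y}^k$ identified with $\mathcal{U}^k$). Conventions: the sequence $k(n)$ is deterministic with $1\le k(n)\le n$. $X$ and $Y$ may be defined on different probability spaces and nothing is assumed about their joint dependence; ''almost surely'' means for all $X$ in a set of $\mu$-measure one and all $Y$ in a set of $\nu$-measure one. A sequence of measures $\gamma^n$ converges weakly to a set $\Gamma$, written $\gamma^n\Rightarrow\Gamma$, if every subsequence of $\gamma^n$ has a further subsequence converging weakly to an element of $\Gamma$. *)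

(* Defs.v *)
From HB Require Import structures.
From mathcomp Require Import all_boot all_order all_algebra.
From mathcomp Require Import all_classical all_reals all_analysis.

Set Implicit Arguments.
Unset Strict Implicit.
Unset Printing Implicit Defensive.
Import Order.TTheory GRing.Theory Num.Theory.
Import numFieldNormedType.Exports.

Local Open Scope classical_set_scope.
Local Open Scope ring_scope.
Local Open Scope ereal_scope.

(* A finite set carrying a probability measure is nonempty; the chosen point
   only serves to make the spaces below measurable types of the library. *)
#[short(type="pfinType")]
HB.structure Definition PointedFinite := {T of Finite T & Pointed T}.

HB.instance Definition _ (X Y : pfinType) := Pointed.on (X * Y)%type.

Notation borel T := (g_sigma_algebraType (@open T)).

(* The coordinate u_i (i >= 1) of a sequence is [u i.-1]. *)
Definition seqspace (U : pointedType) : Type :=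
  prod_topology (fun _ : nat => discrete_topology U).
HB.instance Definition _ (U : pointedType) := Pointed.on (seqspace U).
HB.instance Definition _ (U : pointedType) := Topological.on (seqspace U).

Definition blockspace (U : pointedType) (k : nat) : Type :=
  discrete_topology (k.-tuple U).
HB.instance Definition _ (U : pointedType) k := Pointed.on (blockspace U k).
HB.instance Definition _ (U : pointedType) k :=
  DiscreteTopology.on (blockspace U k).

Section sequences.
Context {U : pfinType}.

Definition left_shift (u : seqspace U) : seqspace U := fun i => u i.+1.

Definition window (k l : nat) (u : seqspace U) : blockspace U k :=
  [tuple u (l + i)%N | i < k].

Lemma left_shift_continuous : continuous left_shift.
Proof.
move=> u.
have F0 : Filter (nbhs u) by exact: (@nbhs_filter (seqspace U)).
have F1 : Filter (fmap left_shift (nbhs u)) by exact: fmap_filter.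
apply/cvg_sup => i A [V [[W oW <-] Wu VA]].
apply: (filterS VA).
apply: (@proj_continuous nat (fun=> discrete_topology U) i.+1 u).
exact: open_nbhs_nbhs.
Qed.

Lemma measurable_left_shift :
  measurable_fun setT (left_shift : borel (seqspace U) -> borel (seqspace U)).
Proof.
apply: (@measurability _ _ (borel (seqspace U)) (borel (seqspace U)) setT
  left_shift (@open (seqspace U))) => // _ [A oA <-]; rewrite setTI.
apply: sub_sigma_algebra; move: A oA.
exact/continuousP/left_shift_continuous.
Qed.

Lemma measurable_iter_left_shift l :
  measurable_fun setT
    (iter l left_shift : borel (seqspace U) -> borel (seqspace U)).
Proof.
elim: l => [|l IHl]; first exact: measurable_id.
exact: measurableT_comp measurable_left_shift IHl.
Qed.

End sequences.

Section stationarity.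
Context {R : realType} {U : pfinType}.

Definition stationary : set (probability (borel (seqspace U)) R) :=
  [set mu : probability (borel (seqspace U)) R |
    forall A : set (borel (seqspace U)), measurable A ->
      mu (left_shift @^-1` A) = mu A].

Definition ergodic (mu : probability (borel (seqspace U)) R) : Prop :=
  forall A : set (borel (seqspace U)), measurable A ->
    left_shift @^-1` A = A -> mu A = 0 \/ mu A = 1.

Definition marginal (k : nat) (g : {measure set borel (seqspace U) -> \bar R}) :
    set (borel (blockspace U k)) -> \bar R :=
  pushforward g (window k 0 : borel (seqspace U) -> borel (blockspace U k)).

End stationarity.

Arguments marginal {R U} k g.

Section transport.
Context {R : realType} {U V W : ptopologicalType}.
(* [p] and [q] are the projections which identify [W] with [U * V]. *)
Variables (p : W -> U) (q : W -> V).

Definition couplings (a : probability (borel U) R) (b : probability (borel V) R) :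
    set (probability (borel W) R) :=
  [set w : probability (borel W) R |
    (forall A : set (borel U), measurable A -> w (p @^-1` A) = a A) /\
    (forall B : set (borel V), measurable B -> w (q @^-1` B) = b B)].

Definition coupling_cost (d : U -> V -> R) (w : probability (borel W) R) : \bar R :=
  \int[w]_z (d (p z) (q z))%:E.

Definition transport_cost (d : U -> V -> R) a b : \bar R :=
  ereal_inf [set coupling_cost d w | w in couplings a b].

Definition optimal_couplings (d : U -> V -> R) a b :
    set (probability (borel W) R) :=
  [set w : probability (borel W) R |
    couplings a b w /\ coupling_cost d w = transport_cost d a b].

End transport.

Section joinings.
Context {R : realType} {X Y : pfinType}.
Variable c : X -> Y -> R.

Definition seq_fst (z : seqspace (X * Y)%type) : seqspace X := fun i => (z i).1.
Definition seq_snd (z : seqspace (X * Y)%type) : seqspace Y := fun i => (z i).2.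

Definition joinings (mu : probability (borel (seqspace X)) R)
    (nu : probability (borel (seqspace Y)) R) :
    set (probability (borel (seqspace (X * Y)%type)) R) :=
  couplings seq_fst seq_snd mu nu `&` stationary.

Definition joining_cost (la : probability (borel (seqspace (X * Y)%type)) R) :
    \bar R :=
  \int[marginal 1 la]_z (c (thead z).1 (thead z).2)%:E.

Definition optimal_joining_cost mu nu : \bar R :=
  ereal_inf [set joining_cost la | la in joinings mu nu].

Definition optimal_joinings mu nu :
    set (probability (borel (seqspace (X * Y)%type)) R) :=
  [set la : probability (borel (seqspace (X * Y)%type)) R |
    joinings mu nu la /\ joining_cost la = optimal_joining_cost mu nu].

End joinings.

Section empirical.
Context {R : realType} {U : pfinType}.

(* The denominator is n - k + 1; the definition is meant for k <= n. *)
Definition empirical (k n : nat) (x : seqspace U) :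
    set (borel (blockspace U k)) -> \bar R :=
  mscale (((n - k).+1%:R^-1 : R)%:nng)%R
    (msum (fun l => \d_(window k l x : borel (blockspace U k))) (n - k).+1).

Arguments empirical : clear implicits.

HB.instance Definition _ k n x := Measure.on (empirical k n x).

Let empiricalE k n x (A : set (borel (blockspace U k))) :
  empirical k n x A = ((n - k).+1%:R^-1)%:E *
    \sum_(l < (n - k).+1) \d_(window k l x : borel (blockspace U k)) A.
Proof. by []. Qed.

Let empirical_setT k n x : empirical k n x setT = 1.
Proof.
rewrite empiricalE (eq_bigr (fun=> 1)); last by move=> l _; rewrite diracT.
by rewrite sumEFin -EFinM sumr_const card_ord -mulr_natr mul1r mulVf.
Qed.

HB.instance Definition _ k n x :=
  Measure_isProbability.Build _ _ _ (empirical k n x) (empirical_setT k n x).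

Lemma empirical_set1 k n x (w : k.-tuple U) :
  empirical k n x [set w] =
  ((n - k).+1%:R^-1 * \sum_(l < (n - k).+1) (w == window k l x)%:R)%:E.
Proof.
rewrite empiricalE EFinM -sumEFin; congr (_ * _); apply: eq_bigr => l _.
rewrite diracE; case: eqP => [->|wx]; first by rewrite mem_set.
by rewrite memNset// => xw; apply: wx; rewrite xw.
Qed.

End empirical.

Arguments empirical : clear implicits.

Section block_iid.
Context {R : realType} {U : pfinType}.
Variable k : nat.
Variable g : probability (borel (blockspace U k)) R.

Definition block_event (j : nat) (A : set (borel (blockspace U k))) :
    set (borel (seqspace U)) :=
  window k (j * k) @^-1` A.

Definition iid_blocks : set (probability (borel (seqspace U)) R) :=
  [set P : probability (borel (seqspace U)) R |
    (forall j (A : set (borel (blockspace U k))),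
      measurable A -> P (block_event j A) = g A) /\
    (forall (J : seq nat) (A : nat -> set (borel (blockspace U k))),
      uniq J -> (forall j, measurable (A j)) ->
      P (\bigcap_(j in [set` J]) block_event j (A j)) =
      \prod_(j <- J) P (block_event j (A j)))].

(* For k > 0, [iid_blocks] has exactly one element, the infinite product of g,
   so [get] is a definite description. *)
Definition iid_block_measure : probability (borel (seqspace U)) R :=
  get iid_blocks.

(* U^l * A is the preimage of A under the l-th iterate of the shift. *)
Definition block_process (A : set (borel (seqspace U))) : \bar R :=
  (k%:R^-1)%:E *
  \sum_(l < k) iid_block_measure (iter l left_shift @^-1` A).

Let block_process0 : block_process set0 = 0.
Proof.
rewrite /block_process big1 ?mule0// => l _.
by rewrite preimage_set0 measure0.
Qed.

Let block_process_ge0 A : 0 <= block_process A.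
Proof.
by rewrite mule_ge0 ?lee_fin ?invr_ge0// sume_ge0.
Qed.

Let block_process_sigma_additive : semi_sigma_additive block_process.
Proof.
pose m (l : nat) : {measure set borel (seqspace U) -> \bar R} :=
  measure_function_pushforward__canonical__measure_function_Measure
    iid_block_measure (@measurable_iter_left_shift U l).
exact: (@measure_semi_sigma_additive _ _ _
  (mscale ((k%:R^-1 : R)%:nng)%R (msum m k))).
Qed.

HB.instance Definition _ := isMeasure.Build _ _ _
  block_process block_process0 block_process_ge0 block_process_sigma_additive.

Lemma block_process_setT : (0 < k)%N -> block_process setT = 1.
Proof.
move=> k0; rewrite /block_process (eq_bigr (fun=> 1)) => [|l _].
  rewrite sumEFin -EFinM sumr_const card_ord -mulr_natr mul1r mulVf//.
  by rewrite pnatr_eq0 -lt0n.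
by rewrite preimage_setT probability_setT.
Qed.

End block_iid.

Arguments block_process {R U} k g.

Section weak_convergence.
Context {R : realType} {T : ptopologicalType}.

Definition weak_cvg (g_ : nat -> {measure set borel T -> \bar R})
    (g : {measure set borel T -> \bar R}) : Prop :=
  forall f : T -> R, continuous f -> bounded_fun f ->
    \int[g_ n]_x (f x)%:E @[n --> \oo] --> \int[g]_x (f x)%:E.

Definition weak_cvg_set (g_ : nat -> {measure set borel T -> \bar R})
    (G : set (probability (borel T) R)) : Prop :=
  forall s : nat -> nat, {homo s : m n / (m < n)%N} ->
    exists t : nat -> nat, {homo t : m n / (m < n)%N} /\
      exists2 g, G g & weak_cvg (fun n => g_ (s (t n))) g.

End weak_convergence.

Section estimators.
Context {R : realType} {X Y : pfinType}.
Variable c : X -> Y -> R.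

Definition block_fst k (z : blockspace (X * Y)%type k) : blockspace X k :=
  [tuple (tnth z i).1 | i < k].
Definition block_snd k (z : blockspace (X * Y)%type k) : blockspace Y k :=
  [tuple (tnth z i).2 | i < k].

Definition block_cost k (x : blockspace X k) (y : blockspace Y k) : R :=
  (\sum_(l < k) c (tnth x l) (tnth y l))%R.

Definition cost_estimate (k n : nat) (x : seqspace X) (y : seqspace Y) : \bar R :=
  (k%:R^-1)%:E * transport_cost (@block_fst k) (@block_snd k) (@block_cost k)
                   (empirical R X k n x) (empirical R Y k n y).

Definition optimal_block_couplings (k n : nat) (x : seqspace X) (y : seqspace Y) :
    set (probability (borel (blockspace (X * Y)%type k)) R) :=
  optimal_couplings (@block_fst k) (@block_snd k) (@block_cost k)
    (empirical R X k n x) (empirical R Y k n y).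

End estimators.

Arguments cost_estimate {R X Y} c k n x y.
Arguments optimal_block_couplings {R X Y} c k n x y.

(* Main.v *)
Require Import Defs.
From HB Require Import structures.
From mathcomp Require Import all_boot all_order all_algebra.
From mathcomp Require Import all_classical all_reals all_analysis.
From mathcomp Require Import measurable_realfun.
From mathcomp Require Import ring lra zify.

(** The estimator is consistent as soon as the block length k(n) tends to
    infinity so slowly that the empirical laws of k(n)-words are close, in
    total variation, to the true marginals of mu and nu.

    Such lengths exist by the ergodic theorem. It is proved here for indicators
    (frequency_cvg), along the lines of Katznelson and Weiss: if B reaches
    frequency a from almost every point, long orbits are mostly covered by
    segments in which B has frequency at least a, and stationarity gives a <=
    mu B (frequency_le_measure); ergodicity turns this into almost sure bounds
    on the frequencies. Hence for each k the distance word_dist between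
    empirical and true laws of k-words tends to 0 almost surely. Egorov's
    theorem and the Borel-Cantelli lemma replace the random rates by
    deterministic waiting times, common to mu and nu, and k(n) is the largest
    length whose waiting time has passed (good_block_lengths).

    The rest is deterministic. For the upper bound, the k-marginal of a joining
    couples the k-marginals of mu and nu at k times the joining cost. Thinning
    this coupling and redistributing the missing mass gives a coupling of the
    empirical laws whose cost per letter exceeds the joining cost by at most a
    constant times word_dist (perturb_coupling, cost_estimate_ub).

    For the lower bound and the convergence of the joinings, consider the block
    processes of any couplings of the empirical laws. Their cylinder
    probabilities have convergent subsequences, the limits are consistent and
    define a probability (kolmogorov_extension, cylinder_compactness), and
    convergence on cylinders implies weak convergence since continuous
    functions on the compact sequence space are uniformly approximated by
    functions of a prefix (weak_cvg_cylinders). Every limit is a joining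
    (limit_joining): averaging over the k shifts makes the block process
    stationary up to 1/k, and all but a fraction of order 1/k of the windows of
    fixed size lie inside one block, where the marginals are the empirical
    laws. The cost of the first letter passes to the limit. Therefore no limit
    of estimates lies below the optimal joining cost; together with the upper
    bound the estimates converge to it (cost_estimate_cvg), and limits of
    optimal block processes are optimal joinings
    (block_process_cvg_optimal). *)

Set Implicit Arguments.
Unset Strict Implicit.
Unset Printing Implicit Defensive.
Import Order.TTheory GRing.Theory Num.Theory.
Import numFieldNormedType.Exports.

Local Open Scope classical_set_scope.
Local Open Scope ring_scope.

(** * Prefixes and compactness of sequence spaces *)

Section prefixes.
Context {U : pfinType}.
Implicit Types (u v : seqspace U) (m : nat) (A : set (seqspace U)).

(** These sets are clopen; they form the algebra on which measures are built
    and compared. *)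
Definition of_level m A :=
  forall u v, mkseq u m = mkseq v m -> A u -> A v.

Lemma mkseq_eqP m (u v : nat -> U) :
  mkseq u m = mkseq v m <-> forall i, (i < m)%N -> u i = v i.
Proof.
split=> [e i im|e]; last first.
  by apply/eq_in_map => i; rewrite mem_iota add0n => /andP[_]; exact: e.
by have := congr1 (nth point ^~ i) e; rewrite /= !nth_mkseq.
Qed.

Lemma mkseq_eq_le m m' (u v : nat -> U) : (m <= m')%N ->
  mkseq u m' = mkseq v m' -> mkseq u m = mkseq v m.
Proof.
move=> mm' /mkseq_eqP e; apply/mkseq_eqP => i im.
by apply: e; rewrite (leq_trans im).
Qed.

Lemma of_level_le m m' A : (m <= m')%N -> of_level m A -> of_level m' A.
Proof. by move=> mm' lA u v /(mkseq_eq_le mm'); exact: lA. Qed.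

Lemma nbhs_prefix m u : nbhs u [set v : seqspace U | mkseq v m = mkseq u m].
Proof.
have FF : Filter (nbhs u) by exact: (@nbhs_filter (seqspace U)).
elim: m => [|m IHm].
  by rewrite (_ : [set v | _] = setT) ?eqEsubset//; exact: filterT.
have um : nbhs u [set v : seqspace U | v m = u m].
  exact: (@proj_continuous nat (fun=> discrete_topology U) m u [set u m]
            (@discrete_set1 (discrete_topology U) (u m))).
apply: filterS (filterI IHm um) => v [/= e1 e2].
by rewrite !mkseqS e1 e2.
Qed.

Lemma of_level_open m A : of_level m A -> open A.
Proof.
move=> lA; rewrite openE => u Au; rewrite /interior.
have FF : Filter (nbhs u) by exact: (@nbhs_filter (seqspace U)).
by apply: filterS (nbhs_prefix m u) => v /= e; exact: lA Au.
Qed.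

Lemma of_levelC m A : of_level m A -> of_level m (~` A).
Proof. by move=> lA u v uv Au Av; apply: Au; apply: lA Av. Qed.

(** The sets containing all points with a long common prefix with u form a
    filter converging to u in each coordinate, hence in the product
    topology. *)
Lemma nbhsP_prefix u A :
  nbhs u A -> exists m, [set v : seqspace U | mkseq v m = mkseq u m] `<=` A.
Proof.
pose F : set_system (seqspace U) := fun B =>
  exists m, [set v : seqspace U | mkseq v m = mkseq u m] `<=` B.
have FF : Filter F.
  split; first by exists 0%N.
    move=> B C [m mB] [m' mC]; exists (maxn m m') => v /= e; split.
      by apply/mB/(mkseq_eq_le (leq_maxl m m') e).
    by apply/mC/(mkseq_eq_le (leq_maxr m m') e).
  by move=> B C BC [m mB]; exists m; apply: subset_trans BC.
suff : F --> u by apply.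
apply/cvg_sup => i B [V [[W oW <-] Wu VB]].
exists i.+1 => v /= /mkseq_eqP e; apply: VB => /=.
by rewrite /= (e i (ltnSn i)).
Qed.

Lemma seqspace_compact : compact [set: seqspace U].
Proof.
have fU : compact [set: discrete_topology U].
  by apply: finite_compact; exact: finite_finset.
have := @tychonoff nat (fun=> discrete_topology U) (fun=> setT) (fun=> fU).
by congr (compact _); rewrite eqEsubset.
Qed.

(** Compactness for increasing covers, the form that serves both countable
    additivity and uniform continuity. *)
Lemma open_exhaustion (G : nat -> set (seqspace U)) :
  (forall n, open (G n)) -> (forall m n, (m <= n)%N -> G m `<=` G n) ->
  (forall u, exists n, G n u) -> exists n, G n = setT.
Proof.
move=> oG ndG covG.
have := seqspace_compact; rewrite compact_cover => /(_ nat setT G).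
case=> [//|u _|D _ GD].
  by have [n Gn] := covG u; exists n.
exists (\max_(i <- finmap.enum_fset D) i)%N.
rewrite -subTset => u /GD[i Di Gi]; apply: (ndG i) => //.
by apply: (@leq_bigmax_seq _ _ xpredT id).
Qed.

(** The points around which f oscillates by at most e on sequences sharing m
    letters form an open exhaustion as m grows. *)
Lemma continuous_prefix (R : realType) (f : seqspace U -> R) (e : R) :
  continuous f -> 0 < e ->
  exists m, forall u v, mkseq u m = mkseq v m -> `|f u - f v| <= e.
Proof.
move=> cf e0.
pose G m := [set u : seqspace U | forall v, mkseq v m = mkseq u m ->
   forall w, mkseq w m = mkseq u m -> `|f v - f w| <= e].
have [||u|m Gm] := @open_exhaustion G.
- move=> m; apply: (@of_level_open m) => u v uv Gu w wv w' w'v.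
  by apply: Gu; rewrite uv.
- move=> m m' mm' u Gu v vu w wu; apply: Gu; exact: mkseq_eq_le mm' _.
- have e2 : 0 < e / 2 by rewrite divr_gt0.
  have /cvgrPdist_lt/(_ _ e2)/nbhsP_prefix[m mu] := cf u.
  exists m => v /mu/= v2 w /mu/= w2.
  rewrite -(subrK (f u) (f v)) -addrA (le_trans (ler_normD _ _))//.
  by rewrite distrC; lra.
- exists m => u v uv; have : G m v by rewrite Gm.
  by move=> /(_ u uv v erefl).
Qed.

End prefixes.

(** * Extension of consistent cylinder weights to measures *)

Lemma sum_tuple_rcons (U : finType) (V : nmodType) m (F : seq U -> V) :
  \sum_(w : m.+1.-tuple U) F w =
  \sum_(w : m.-tuple U) \sum_(v : U) F (rcons w v).
Proof.
rewrite pair_bigA /=.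
have rconsK (w : m.+1.-tuple U) :
    size (take m w) == m by rewrite size_take size_tuple ltnSn.
rewrite (reindex (fun p : m.-tuple U * U => [tuple of rcons p.1 p.2])) //=.
exists (fun w : m.+1.-tuple U => (Tuple (rconsK w), tnth w ord_max)).
  move=> [w v] _; congr pair.
    by apply/val_inj; rewrite /= -cats1 take_size_cat// size_tuple.
  by rewrite (tnth_nth v) /= nth_rcons size_tuple ltnn eqxx.
move=> w _; apply/val_inj => /=.
rewrite (tnth_nth (tnth w ord_max)) /= -take_nth ?size_tuple//.
by rewrite take_oversize// size_tuple.
Qed.

(** The letters beyond the word are a default choice, invisible to sets of
    level at most its length. *)
Definition extend (U : pfinType) (w : seq U) : seqspace U :=
  fun i => nth point w i.

Lemma mkseq_extend (U : pfinType) (w : seq U) : mkseq (extend w) (size w) = w.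
Proof. exact: mkseq_nth. Qed.

Lemma mkseq_extend_tuple (U : pfinType) m (w : m.-tuple U) :
  mkseq (extend w) m = w.
Proof. by rewrite -{2}(mkseq_extend w) size_tuple. Qed.

Definition cylinder (U : pfinType) (w : seq U) : set (seqspace U) :=
  [set u | mkseq u (size w) = w].

Lemma cylinder_level (U : pfinType) (w : seq U) : of_level (size w) (cylinder
  w).
Proof. by move=> u v e; rewrite /cylinder/= e. Qed.

(** A separate alias to carry the algebra of sets of finite level. *)
Definition level_space (U : pfinType) : Type := seqspace U.
HB.instance Definition _ (U : pfinType) := Pointed.on (level_space U).

Section level_algebra.
Context {U : pfinType}.
Definition level_sets : set (set (level_space U)) :=
  [set A | exists m, of_level m A].

Let level0 : level_sets set0.
Proof. by exists 0%N. Qed.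

Let levelU : setU_closed level_sets.
Proof.
move=> A B [m lA] [m' lB]; exists (maxn m m') => u v e [Au|Bu]; [left|right].
  exact: (lA _ _ (mkseq_eq_le (leq_maxl m m') e)).
exact: (lB _ _ (mkseq_eq_le (leq_maxr m m') e)).
Qed.

Let levelC : setC_closed level_sets.
Proof. by move=> A [m lA]; exists m; exact: of_levelC. Qed.

HB.instance Definition _ := isAlgebraOfSets.Build default_measure_display
  (level_space U) level0 levelU levelC.
End level_algebra.

(** The points whose first n letters already force membership in A form a set
    of level n, and an open set is the union of these sets over n. *)
Lemma open_generated (U : pfinType) (A : set (seqspace U)) :
  open A -> <<s @level_sets U >> A.
Proof.
move=> oA.
have -> : A = \bigcup_n
    [set u | [set v : seqspace U | mkseq v n = mkseq u n] `<=` A].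
  rewrite eqEsubset; split=> [u Au|u [n _]]; last exact.
  have [n nA] := nbhsP_prefix (open_nbhs_nbhs (conj oA Au)).
  by exists n.
apply: (@bigcupT_measurable _ (g_sigma_algebraType (@level_sets U))) => n.
apply: sub_sigma_algebra; exists n => u v uv uA w /= wv.
by apply: uA; rewrite /= uv.
Qed.

Section kolmogorov.
Context {R : realType} {U : pfinType}.
Variable p : seq U -> R.
Hypotheses (p_ge0 : forall w, 0 <= p w) (p_nil : p [::] = 1).
Hypothesis p_rcons : forall w, p w = \sum_v p (rcons w v).

(* Consistency of p makes this weight independent of the level m at which A is
   read. *)
Let mass m (A : set (level_space U)) : R :=
  \sum_(w : m.-tuple U) \1_A (extend w) * p w.

Let massS m A : of_level m A -> mass m.+1 A = mass m A.
Proof.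
move=> lA.
rewrite /mass (sum_tuple_rcons m (fun w => \1_A (extend w) * p w)).
apply: eq_bigr => w _; rewrite [in RHS]p_rcons mulr_sumr.
apply: eq_bigr => v _; congr (_ * _); rewrite !indicE; congr (nat_of_bool _)%:R.
have e : mkseq (extend (rcons w v)) m = mkseq (extend w) m.
  by apply/mkseq_eqP => i im; rewrite /extend nth_rcons size_tuple im.
by apply/idP/idP; rewrite !inE; exact: lA.
Qed.

Let mass_le m m' A : (m <= m')%N -> of_level m A -> mass m' A = mass m A.
Proof.
move=> mm' lA; rewrite -(subnK mm'); elim: (m' - m)%N => // i IHi.
by rewrite addSn massS//; exact: of_level_le (leq_addl _ _) lA.
Qed.

Let rank (A : set (level_space U)) : nat :=
  if pselect (level_sets A) is left h then projT1 (cid h) else 0.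

Let rankP A : level_sets A -> of_level (rank A) A.
Proof. by rewrite /rank; case: pselect => // h _; exact: projT2 (cid h). Qed.

Definition level_content (A : set (level_space U)) : \bar R :=
  (mass (rank A) A)%:E.

Let contentE m A : of_level m A -> level_content A = (mass m A)%:E.
Proof.
move=> lA; rewrite /level_content.
have lA' : of_level (rank A) A by apply: rankP; exists m.
rewrite -(mass_le (leq_maxl (rank A) m) lA').
by rewrite -(mass_le (leq_maxr (rank A) m) lA).
Qed.

Let mass_ge0 m A : 0 <= mass m A.
Proof. by apply: sumr_ge0 => w _; rewrite mulr_ge0// indicE. Qed.

Let content_ge0 A : (0 <= level_content A)%E.
Proof. by rewrite lee_fin. Qed.

Let content0 : level_content set0 = 0%E.
Proof.
rewrite (@contentE 0)// /mass big1// => w _.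
by rewrite indicE in_set0 mul0r.
Qed.

Let content_additive : measure_function.semi_additive level_content.
Proof.
apply/additive2P => // A B [m lA] [m' lB] AB0.
have lA' := of_level_le (leq_maxl m m') lA.
have lB' := of_level_le (leq_maxr m m') lB.
have lAB : of_level (maxn m m') (A `|` B).
  by move=> u v uv [/(lA' _ _ uv)|/(lB' _ _ uv)]; [left|right].
rewrite (contentE lAB) (contentE lA') (contentE lB') -EFinD; congr (_%:E).
rewrite -big_split/=; apply: eq_bigr => w _; rewrite -mulrDl; congr (_ * _).
rewrite !indicE in_setU -natrD; congr (_%:R).
have : ~ (A `&` B) (extend w) by rewrite AB0.
case: (boolP (_ \in A)) => [/set_mem Aw|_]; last by case: (_ \in B).
by case: (boolP (_ \in B)) => [/set_mem Bw|//]; case.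
Qed.

HB.instance Definition _ := isContent.Build _ _ _ level_content
  content_ge0 content_additive.

(** A set of finite level is compact and open, so a countable cover by such
    sets has a finite subcover, for which finite subadditivity is enough. *)
Let content_subadditive : measurable_subset_sigma_subadditive level_content.
Proof.
move=> A F mF mA AF.
pose G n : set (seqspace U) := ~` A `|` \big[setU/set0]_(i < n) F i.
have mG n : level_sets (G n).
  apply: (@measurableU _ (level_space U)); first exact: measurableC.
  by apply: bigsetU_measurable => i _; exact: mF.
have [||u|n Gn] := @open_exhaustion U G.
- by move=> n; have [m lG] := mG n; exact: of_level_open lG.
- move=> m n mn u [Au|Fu]; [by left|right].
  move: Fu; rewrite -!bigcup_mkord => -[i /= im Fi].
  by exists i => //=; exact: leq_trans mn.
- have [Au|Au] := pselect (A u); last by exists 0%N; left.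
  have [i _ Fi] := AF u Au; exists i.+1; right.
  by rewrite -bigcup_mkord; exists i => /=.
have AFn : A `<=` \big[setU/set0]_(i < n) F i.
  by move=> u Au; have [//|//] : G n u by rewrite Gn.
apply: (@le_trans _ _ (\sum_(i < n) level_content (F i))).
  exact: (content_subadditive level_content (fun k _ => mF k) mA AFn).
rewrite -(big_mkord xpredT (fun i => level_content (F i))).
exact: nneseries_lim_ge.
Qed.

HB.instance Definition _ := Content_SigmaSubAdditive_isMeasure.Build _ _ _
  level_content content_subadditive.

Let id_measurable : measurable_fun setT
  (id : g_sigma_algebraType level_sets -> borel (seqspace U)).
Proof.
apply: (@measurability _ _ _ (borel (seqspace U)) setT _ (@open (seqspace U))).
- by [].
- by move=> _ [A oA <-]; rewrite setTI; exact: open_generated.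
Qed.

Let extension_measure : {measure set borel (seqspace U) -> \bar R} :=
  measure_function_pushforward__canonical__measure_function_Measure
    (measure_extension level_content) id_measurable.

Definition kolmogorov_measure : set (borel (seqspace U)) -> \bar R :=
  extension_measure.

HB.instance Definition _ := isMeasure.Build _ _ _ kolmogorov_measure
  (measure0 extension_measure) (measure_ge0 extension_measure)
  (@measure_semi_sigma_additive _ _ _ extension_measure).

Let kolmogorov_cylinder w : kolmogorov_measure (cylinder w) = (p w)%:E.
Proof.
have lw : of_level (size w) (cylinder w) by exact: cylinder_level.
rewrite /kolmogorov_measure /= /pushforward preimage_id.
rewrite /measure_extension measurable_mu_extE//; last by exists (size w).
rewrite /= (contentE lw) /mass; congr (_%:E).
rewrite (bigD1 (in_tuple w))//= indicE mem_set ?mul1r; last first.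
  exact: mkseq_extend.
rewrite big1 ?addr0// => v vw; rewrite indicE memNset ?mul0r//.
rewrite /cylinder/= => e; move/eqP: vw; apply; apply/val_inj => /=.
by rewrite -[in RHS]e mkseq_extend_tuple.
Qed.

Let kolmogorov_setT : kolmogorov_measure setT = 1%E.
Proof.
have <- : cylinder [::] = [set: seqspace U] by rewrite eqEsubset.
by rewrite kolmogorov_cylinder p_nil.
Qed.

HB.instance Definition _ := Measure_isProbability.Build _ _ _
  kolmogorov_measure kolmogorov_setT.

(** The content is a measure on the algebra of sets of finite level; its
    Caratheodory extension is carried to the Borel sets, which this algebra
    generates. *)
Lemma kolmogorov_extension : exists P : probability (borel (seqspace U)) R,
  forall w, P (cylinder w) = (p w)%:E.
Proof. by exists kolmogorov_measure; exact: kolmogorov_cylinder. Qed.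

End kolmogorov.

Lemma measure_finType d (T : measurableType d) (R : realType)
    (mu : {measure set T -> \bar R}) (I : finType) (P : pred I)
    (F : I -> set T) :
  (forall i, measurable (F i)) -> trivIset setT F ->
  mu (\bigcup_(i in [set i | P i]) F i) = (\sum_(i | P i) mu (F i))%E.
Proof.
move=> mF tF; rewrite measure_fin_bigcup//; last 2 first.
- exact: finite_finset.
- exact: sub_trivIset tF.
rewrite -[RHS]big_filter.
rewrite [RHS](@fsbig_seq _ _ _ _ _ (fun i => mu (F i))); last first.
  by apply: filter_uniq; exact: index_enum_uniq.
congr (\big[_/_]_(_ \in _) _); rewrite eqEsubset; split=> i /=.
  by rewrite mem_filter mem_index_enum andbT.
by rewrite mem_filter => /andP[].
Qed.

Section cylinder_unique.
Context {R : realType} {U : pfinType}.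

Lemma open_measurable_borel (T : ptopologicalType) (A : set (borel T)) :
  @open T A -> measurable A.
Proof. exact: sub_sigma_algebra. Qed.

Lemma of_level_measurable m (A : set (borel (seqspace U))) :
  of_level m A -> measurable A.
Proof. by move=> /of_level_open; exact: open_measurable_borel. Qed.

Lemma cylinder_measurable w :
  measurable (cylinder w : set (borel (seqspace U))).
Proof. exact: of_level_measurable (@cylinder_level U w). Qed.

Lemma level_decomp (mu : {measure set borel (seqspace U) -> \bar R}) m A :
  of_level m A ->
  mu A = (\sum_(w : m.-tuple U | extend w \in A) mu (cylinder w))%E.
Proof.
move=> lA; rewrite -(@measure_finType _ (borel (seqspace U)) R mu (m.-tuple U) _
  (fun w => cylinder w)).
- congr (mu _); rewrite eqEsubset; split=> [u Au|u [w /= Aw uw]].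
    have mu_ : size (mkseq u m) == m by rewrite size_mkseq.
    have e : mkseq (extend (mkseq u m)) m = mkseq u m.
      by rewrite -{2}(size_mkseq u m) mkseq_extend.
    exists (Tuple mu_); last by rewrite /cylinder/= size_mkseq.
    by apply/mem_set/(lA u) => //=.
  move: uw Aw; rewrite /cylinder/= size_tuple => uw /set_mem; apply: lA.
  by rewrite uw mkseq_extend_tuple.
- by move=> w; exact: cylinder_measurable.
- move=> w w' _ _ [u [/= uw uw']]; apply/val_inj; rewrite /= -uw -uw'.
  by rewrite !size_tuple.
Qed.

(** Cylinders determine a measure on the sets of finite level, which are stable
    under intersection and generate the Borel sets. *)
Lemma eq_probability_cylinder
    (m1 m2 : {measure set borel (seqspace U) -> \bar R}) :
  (forall w, m1 (cylinder w) = m2 (cylinder w)) ->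
  (m1 setT < +oo)%E ->
  forall A, measurable A -> m1 A = m2 A.
Proof.
move=> m12 m1oo A mA.
have lm : (@level_sets U : set (set (borel (seqspace U)))) `<=` measurable.
  by move=> B [m]; exact: of_level_measurable.
apply: (@g_sigma_algebra_measure_unique _ _ _ _ lm (fun=> setT)).
- by move=> _; exists 0%N.
- by rewrite eqEsubset; split=> // u _; exists 0%N.
- exact: (@measurableI _ (level_space U)).
- move=> B [m lB]; rewrite (level_decomp m1 lB) (level_decomp m2 lB).
  by apply: eq_bigr => w _; exact: m12.
- by [].
have sub : [set B | @open (seqspace U) B] `<=` <<s @level_sets U >>.
  exact: open_generated.
by move: A mA; apply: smallest_sub sub; exact: smallest_sigma_algebra.
Qed.

End cylinder_unique.

(** * Measures on finite block spaces *)

Section block_space.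
Context {R : realType} {U : pfinType} {k : nat}.
Implicit Types (P : {measure set borel (blockspace U k) -> \bar R}).

Lemma block_measurable (A : set (borel (blockspace U k))) : measurable A.
Proof.
by apply: open_measurable_borel; exact: (@discrete_open (blockspace U k)).
Qed.

Lemma block_measureE P (A : set (borel (blockspace U k))) :
  P A = (\sum_(w : k.-tuple U | w \in A) P [set w])%E.
Proof.
rewrite -(@measure_finType _ (borel (blockspace U k)) R P (k.-tuple U) _
  (fun w => [set w])).
- congr (P _); rewrite eqEsubset; split=> [w Aw|w [v /= + ->]].
    by exists w => //=; exact: mem_set.
  by move/set_mem.
- by move=> w; exact: block_measurable.
- by move=> v w _ _ [u [/= <- <-]].
Qed.

Lemma block_fin_num (P : probability (borel (blockspace U k)) R) A :
  P A \is a fin_num.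
Proof. by apply: fin_num_measure; exact: block_measurable. Qed.

Lemma block_integral P (h : k.-tuple U -> R) :
  (forall w, P [set w] \is a fin_num) ->
  (\int[P]_z (h z)%:E)%E = (\sum_w h w * fine (P [set w]))%:E.
Proof.
move=> Pfin.
have -> : [set: borel (blockspace U k)] =
    \big[setU/set0]_(w <- index_enum (k.-tuple U)) [set w].
  rewrite -bigcup_seq eqEsubset; split=> // w _.
  by exists w => //=; exact: mem_index_enum.
rewrite (@integral_bigsetU_EFin _ (borel (blockspace U k)) R P _ (fun w => [set
  w])).
- rewrite -sumEFin; apply: eq_bigr => w _.
  rewrite (eq_integral (cst (h w)%:E)); last by move=> x; rewrite inE => ->.
  rewrite integral_cst; last exact: block_measurable.
  by rewrite EFinM fineK.
- by move=> w; exact: block_measurable.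
- exact: index_enum_uniq.
- by move=> v w _ _ [u [/= <- <-]].
- by move=> _ B _; exact: block_measurable.
Qed.

End block_space.

Section block_pmf.
Context {R : realType} {U : pfinType} {k : nat}.
Variable p : k.-tuple U -> R.
Hypotheses (p_ge0 : forall w, 0 <= p w) (p_sum : \sum_w p w = 1).

Let e := enum {: k.-tuple U}.

Definition pmf_measure : set (borel (blockspace U k)) -> \bar R :=
  msum (fun i => mscale (NngNum (p_ge0 (nth point e i)))
    (dirac (nth point e i : borel (blockspace U k)))) (size e).

HB.instance Definition _ := Measure.on pmf_measure.

Let pmf_measureE A : pmf_measure A = (\sum_w (p w * \1_A w)%:E)%E.
Proof.
rewrite -[index_enum _]enumT -/e (big_nth point) big_mkord.
by apply: eq_bigr => i _; rewrite /= /mscale/= diracE indicE EFinM.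
Qed.

Let pmf_measure_setT : pmf_measure setT = 1%E.
Proof.
rewrite pmf_measureE sumEFin -[RHS]/(1%:E) -p_sum; congr (_%:E).
by apply: eq_bigr => w _; rewrite indicT mulr1.
Qed.

HB.instance Definition _ := Measure_isProbability.Build _ _ _ pmf_measure
  pmf_measure_setT.

Lemma pmf_probability : exists P : probability (borel (blockspace U k)) R,
  forall w, P [set w] = (p w)%:E.
Proof.
exists pmf_measure => w /=; rewrite pmf_measureE (bigD1 w)//= indicE mem_set//.
rewrite mulr1 big1 ?adde0// => v vw; rewrite indicE memNset ?mulr0// => vw'.
by rewrite vw' eqxx in vw.
Qed.

End block_pmf.

Section windows.
Context {U : pfinType}.

Lemma iter_left_shiftE l (u : seqspace U) i : iter l left_shift u i = u (l +
  i)%N.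
Proof. by elim: l i => // l IHl i; rewrite iterS /left_shift IHl addnS. Qed.

Lemma val_window k l (u : seqspace U) :
  window k l u = mkseq (iter l left_shift u) k :> seq U.
Proof.
apply: (@eq_from_nth _ point); first by rewrite size_tuple size_mkseq.
move=> i; rewrite size_tuple => ik.
rewrite nth_mkseq// -[i]/(val (Ordinal ik)) -tnth_nth tnth_mktuple.
by rewrite iter_left_shiftE.
Qed.

Lemma window_iter k l (u : seqspace U) :
  window k l u = window k 0 (iter l left_shift u).
Proof. by apply/val_inj; rewrite /= !val_window. Qed.

Lemma window_cylinder k (w : k.-tuple U) :
  window k 0 @^-1` [set w] = cylinder w.
Proof.
rewrite eqEsubset /cylinder; split=> u /=.
  by move=> <-; rewrite size_tuple val_window.
by rewrite size_tuple => e; apply/val_inj; rewrite /= val_window.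
Qed.

Lemma window_level k l (A : set (k.-tuple U)) :
  of_level (l + k) (window k l @^-1` A).
Proof.
move=> u v /mkseq_eqP uv /=; congr (A _); apply/eq_from_tnth => i.
by rewrite !tnth_mktuple uv// ltn_add2l.
Qed.

Lemma window_measurable k l :
  measurable_fun setT
    (window k l : borel (seqspace U) -> borel (blockspace U k)).
Proof.
by move=> _ A _; rewrite setTI;
  exact: of_level_measurable (@window_level k l A).
Qed.

Lemma measurable_fun_level d (T : measurableType d)
    (f : T -> borel (seqspace U)) :
  (forall m A, of_level m A -> measurable (f @^-1` A)) ->
  measurable_fun setT f.
Proof.
move=> mf; apply: (@measurability _ _ _ (borel (seqspace U)) _ _ (@level_sets
  U)).
  rewrite eqEsubset; split; apply: smallest_sub.
  - exact: smallest_sigma_algebra.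
  - exact: open_generated.
  - exact: smallest_sigma_algebra.
  - by move=> A [m]; exact: of_level_measurable.
by move=> _ [A [m lA] <-]; rewrite setTI; exact: mf lA.
Qed.

End windows.

(** * Independent blocks *)

Lemma sum_tuple_prod (R : comNzRingType) (V : pfinType) m (h : nat -> V -> R) :
  \sum_(w : m.-tuple V) \prod_(i < m) h i (nth point w i) =
  \prod_(i < m) \sum_v h i v.
Proof.
elim: m => [|m IHm].
  rewrite big_ord0 (big_pred1 [tuple]) ?big_ord0// => w /=.
  by apply/esym/eqP; exact: tuple0.
rewrite (sum_tuple_rcons m (fun w => \prod_(i < m.+1) h i (nth point w i))).
rewrite big_ord_recr/= -IHm mulr_suml; apply: eq_bigr => w _.
rewrite mulr_sumr; apply: eq_bigr => v _.
rewrite big_ord_recr/= nth_rcons size_tuple ltnn eqxx; congr (_ * _).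
by apply: eq_bigr => i _; rewrite nth_rcons size_tuple ltn_ord.
Qed.

Section as_probability.
Context d (T : measurableType d) (R : realType).
Variable m : {measure set T -> \bar R}.
Hypothesis m1 : m setT = 1%E.

Definition normed_measure : set T -> \bar R := m.

HB.instance Definition _ := isMeasure.Build _ _ _ normed_measure
  (measure0 m) (measure_ge0 m) (@measure_semi_sigma_additive _ _ _ m).

HB.instance Definition _ := Measure_isProbability.Build _ _ _
  normed_measure m1.

Lemma probability_of_measure : exists P : probability T R,
  forall A, P A = m A.
Proof. by exists normed_measure. Qed.

End as_probability.

HB.instance Definition _ (U : pfinType) k := Pointed.on (k.-tuple U).

Section iid.
Context {R : realType} {U : pfinType} {k : nat}.
Hypothesis k_gt0 : (0 < k)%N.
Variable g : probability (borel (blockspace U k)) R.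
Let V : pfinType := k.-tuple U.

Definition flatten_blocks (v : seqspace V) : seqspace U :=
  fun i => nth point (v (i %/ k)%N) (i %% k)%N.

Let flatten_measurable : measurable_fun setT
  (flatten_blocks : borel (seqspace V) -> borel (seqspace U)).
Proof.
apply: measurable_fun_level => m A lA; apply: (@of_level_measurable V m).
move=> v v' /mkseq_eqP vv'; apply: lA; apply/mkseq_eqP => i im.
by rewrite /flatten_blocks vv'// (leq_ltn_trans _ im)// leq_div.
Qed.

Let window_flatten j (v : seqspace V) : window k (j * k) (flatten_blocks v) = v
  j.
Proof.
apply/eq_from_tnth => i; rewrite tnth_mktuple /flatten_blocks.
by rewrite divnMDl// modnMDl divn_small// modn_small// addn0 -tnth_nth.
Qed.

Let gp (w : seq V) : R := \prod_(v <- w) fine (g [set v]).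

Let gp_sum : \sum_(v : V) fine (g [set v]) = 1.
Proof.
rewrite sum_fine; last by move=> v _; exact: block_fin_num.
transitivity (fine (g setT)); last by rewrite probability_setT.
rewrite (block_measureE g setT); congr (fine _).
by apply: eq_bigl => v; rewrite in_setT.
Qed.

(** Independent k-blocks are an i.i.d. sequence over the alphabet of k-tuples,
    written letter by letter. Existence guarantees that the measure selected in
    the definition of the block process has the prescribed law. *)
Lemma iid_blocks_nonempty : iid_blocks g !=set0.
Proof.
have [||w|Q QE] := @kolmogorov_extension R V gp.
- by move=> w; apply: prodr_ge0 => v _; exact: fine_ge0.
- by rewrite /gp big_nil.
- rewrite -[LHS]mulr1 -[in LHS]gp_sum mulr_sumr; apply: eq_bigr => v _.
  by rewrite /gp big_rcons.
have prodE (A : nat -> set (borel (blockspace U k))) m :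
    Q (\bigcap_(i in `I_m) [set v : seqspace V | A i (v i)]) =
    (\prod_(i < m) fine (g (A i)))%:E.
  rewrite (@level_decomp R V Q m); last first.
    move=> u v /mkseq_eqP uv Au i /= im; rewrite -uv//; exact: Au.
  rewrite (eq_bigr (fun w : m.-tuple V => (gp w)%:E)); last by move=> w _;
    exact: QE.
  rewrite sumEFin; congr (_%:E).
  have -> : \prod_(i < m) fine (g (A i)) =
      \prod_(i < m) \sum_v (\1_(A i) v * fine (g [set v])).
    apply: eq_bigr => i _; rewrite (block_measureE g (A i)).
    rewrite -sum_fine; last by move=> v _; exact: block_fin_num.
    rewrite big_mkcond; apply: eq_bigr => v _; rewrite indicE.
    by case: (v \in A i); rewrite ?mul1r ?mul0r.
  rewrite -(@sum_tuple_prod _ V m (fun i v => \1_(A i) v * fine (g [set v]))).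
  rewrite big_mkcond; apply: eq_bigr => w _.
  rewrite big_split/= /gp (big_nth point) size_tuple big_mkord.
  case: ifPn => [/set_mem Aw|/negP Aw].
    rewrite [X in _ = X * _]big1 ?mul1r// => i _; rewrite indicE mem_set//.
    exact: (Aw (nat_of_ord i) (ltn_ord i)).
  have [i Ai] : exists i : 'I_m, ~ A i (nth point w i).
    apply: contrapT => /forallNP Ai; apply: Aw; apply/mem_set => i /= im.
    by have /contrapT := Ai (Ordinal im).
  by rewrite [X in _ = X * _](bigD1 i)//= indicE memNset// !mul0r.
pose Pf : {measure set borel (seqspace U) -> \bar R} :=
  measure_function_pushforward__canonical__measure_function_Measure
    Q flatten_measurable.
have [|P PE] := @probability_of_measure _ _ _ Pf.
  by rewrite /= /pushforward preimage_setT probability_setT.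
have indep (J : seq nat) (A : nat -> set (borel (blockspace U k))) : uniq J ->
    P (\bigcap_(j in [set` J]) block_event j (A j)) =
    (\prod_(j <- J) g (A j))%E.
  move=> uJ; rewrite PE /= /pushforward.
  have [m Jm] : exists m, forall j, j \in J -> (j < m)%N.
    exists (\max_(j <- J) j).+1 => j jJ.
    by rewrite ltnS (@leq_bigmax_seq _ _ xpredT id).
  pose A' j := if j \in J then A j else setT.
  transitivity (Q (\bigcap_(i in `I_m) [set v : seqspace V | A' i (v i)])).
    congr (Q _); rewrite eqEsubset; split=> v /= Av j /= jJ.
      rewrite /A'; case: ifPn => // /Av; rewrite /block_event/=.
      by rewrite window_flatten.
    rewrite /block_event/= window_flatten.
    by have := Av j (Jm _ jJ); rewrite /= /A' jJ.
  pose f j := if j \in J then fine (g (A j)) else 1.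
  rewrite prodE (eq_bigr (fun j : 'I_m => f j)).
  - rewrite -(big_mkord xpredT f) /f.
    rewrite -big_mkcond -big_filter.
    rewrite (perm_big J); last first.
      apply: uniq_perm => //; first by apply: filter_uniq; exact: iota_uniq.
      move=> j; rewrite mem_filter mem_index_iota leq0n /=.
      by case: (boolP (j \in J)) => //= /Jm ->.
    rewrite -prodEFin; apply: eq_bigr => j _; rewrite fineK//.
    exact: block_fin_num.
  - by move=> j _; rewrite /A' /f; case: ifP => // _; rewrite probability_setT.
have indep1 j A : P (block_event j A) = g A.
  have := indep [:: j] (fun=> A) erefl; rewrite big_seq1 => <-.
  by congr (P _); rewrite set_cons1 bigcap_set1.
exists P; split=> [j A _|J A uJ _]; first exact: indep1.
by rewrite indep//; apply: eq_bigr => j _; rewrite indep1.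
Qed.

End iid.

(** * Visit frequencies of ergodic measures *)

Section birkhoff.
Context {R : realType} {U : pfinType}.
Variable mu : probability (borel (seqspace U)) R.
Implicit Types (B D : set (borel (seqspace U))) (u : seqspace U).

Definition visits B n (u : borel (seqspace U)) : R :=
  \sum_(i < n) \1_B (iter i left_shift u).

Lemma visitsS B n u :
  visits B n.+1 u = \1_B u + visits B n (left_shift u).
Proof.
rewrite /visits big_ord_recl; congr (_ + _); apply: eq_bigr => i _.
by rewrite lift0 iterSr.
Qed.

Lemma visitsD B m n u :
  visits B (m + n) u = visits B m u + visits B n (iter m left_shift u).
Proof.
rewrite /visits big_split_ord/=; congr (_ + _); apply: eq_bigr => i _.
by rewrite addnC iterD.
Qed.

Lemma visits_ge0 B n u : 0 <= visits B n u.
Proof. by apply: sumr_ge0 => i _; rewrite indicE. Qed.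

Lemma visits_le B n u : visits B n u <= n%:R.
Proof.
apply: (@le_trans _ _ (\sum_(i < n) 1)); last by rewrite sumr_const card_ord.
by apply: ler_sum => i _; rewrite indicE lern1 leq_b1.
Qed.

Lemma visitsC B n u : visits (~` B) n u = n%:R - visits B n u.
Proof.
apply/eqP; rewrite eq_sym subr_eq /visits -big_split/= -[X in X == _]/(n%:R).
rewrite (eq_bigr (fun=> 1)); first by rewrite sumr_const card_ord.
by move=> i _; rewrite !indicE in_setC; case: (_ \in B); rewrite ?addr0 ?add0r.
Qed.

Lemma visits_measurable B n : measurable B -> measurable_fun setT (visits B n).
Proof.
move=> mB; apply: measurable_sum => i.
apply: (@measurableT_comp _ _ _ _ _ _ (\1_B : borel (seqspace U) -> R)).
  exact: measurable_indic.
exact: measurable_iter_left_shift.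
Qed.

(** A long orbit segment splits into segments of length at most N on which the
    frequency of B is at least a, single points of D, and a remainder of length
    at most N. *)
Lemma visits_covering (a : R) (N : nat) B D : 0 <= a <= 1 ->
  (forall u, ~ D u -> exists n, (1 <= n <= N)%N /\ a * n%:R <= visits B n u) ->
  forall L u, a * (L%:R - N%:R) <= visits B L u + visits D L u.
Proof.
move=> /andP[a0 a1] BD; elim/ltn_ind => L IH u.
have [LN|NL] := leqP L N.
  apply: (@le_trans _ _ 0); last by rewrite addr_ge0// visits_ge0.
  by rewrite mulr_ge0_le0// subr_le0 ler_nat.
have [Du|/BD[n [/andP[n1 nN] an]]] := pselect (D u).
  case: L => // L in IH NL *.
  have D1 : \1_D u = 1 :> R by rewrite indicE mem_set.
  have B0 : 0 <= \1_B u :> R by rewrite indicE.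
  have := IH L (ltnSn L) (left_shift u).
  by rewrite !visitsS D1 -natr1 => h; nra.
have nL : (n <= L)%N by rewrite ltnW// (leq_ltn_trans nN).
have Ln : (L - n < L)%N by rewrite ltn_subrL n1 (leq_trans _ NL).
have := IH (L - n)%N Ln (iter n left_shift u).
have vL C : visits C L u =
    visits C n u + visits C (L - n) (iter n left_shift u).
  by rewrite -visitsD subnKC.
rewrite !vL natrB// => h.
by have := visits_ge0 D n u; nra.
Qed.

Hypothesis mu_stationary : stationary mu.

Lemma stationary_iter B i : measurable B ->
  mu (iter i left_shift @^-1` B) = mu B.
Proof.
move=> mB; elim: i => // i IHi; rewrite -[RHS]IHi -[RHS]mu_stationary.
  by congr (mu _); rewrite eqEsubset; split=> u; rewrite /= -iterSr.
have := @measurable_iter_left_shift U i measurableT B mB.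
by rewrite setTI.
Qed.

Lemma integral_visits B n : measurable B ->
  (\int[mu]_u (visits B n u)%:E = (n%:R * fine (mu B))%:E)%E.
Proof.
move=> mB.
have mi i : measurable (iter i left_shift @^-1` B : set (borel (seqspace U))).
  by rewrite -[X in measurable X]setTI; exact: measurable_iter_left_shift.
transitivity (\sum_(i < n)
    \int[mu]_u (\1_(iter i left_shift @^-1` B) u : R)%:E)%E.
  rewrite -ge0_integral_sum//.
  - by apply: eq_integral => u _; rewrite sumEFin.
  - by move=> i; apply/measurable_EFinP; exact: measurable_indic.
rewrite (eq_bigr (fun=> (fine (mu B))%:E)).
  by rewrite sumEFin sumr_const card_ord mulr_natl.
move=> i _; rewrite integral_indic// setIT [LHS](stationary_iter i mB).
by rewrite fineK//; exact: fin_num_measure.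
Qed.

(** Let D be the set of points that have to wait more than N steps until the
    frequency of B reaches a. Integrating visits_covering over a stationary
    measure gives a(L - N) <= L(mu B + mu D) for all L, so a <= mu B + mu D,
    and mu D vanishes as N grows. *)
Lemma frequency_le_measure (a : R) B : measurable B ->
  mu [set u | exists n, (1 <= n)%N /\ a * n%:R <= visits B n u] = 1%E ->
  a <= fine (mu B).
Proof.
move=> mB E1; set b := fine _.
have [a0|a0] := ltP a 0; first by rewrite (le_trans (ltW a0))// fine_ge0.
have mE n : measurable [set u : borel (seqspace U) | a * n%:R <= visits B n u].
  rewrite (_ : [set _ | _] = visits B n @^-1` `[a * n%:R, +oo[%classic).
    by rewrite -[X in measurable X]setTI; exact: visits_measurable.
  by rewrite eqEsubset; split=> u /=; rewrite in_itv/= andbT.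
have a1 : a <= 1.
  rewrite leNgt; apply/negP => a1; move: E1.
  rewrite (_ : [set _ | _] = set0) ?measure0; first by move=> /eqP;
    rewrite eqe eq_sym oner_eq0.
  rewrite -subset0 => u [n [n1 /=]]; apply/negP; rewrite -ltNge.
  rewrite (le_lt_trans (visits_le B n u))// -{1}(mul1r n%:R) ltr_pM2r//.
  by rewrite ltr0n.
pose G N : set (borel (seqspace U)) :=
  [set u | exists n, (1 <= n <= N)%N /\ a * n%:R <= visits B n u].
have mG N : measurable (G N).
  rewrite (_ : G N = \bigcup_(n in [set n | (1 <= n <= N)%N])
      [set u | a * n%:R <= visits B n u]); last first.
    rewrite eqEsubset; split=> u; first by move=> [n [n1 nu]]; exists n.
    by move=> [n /= n1 nu]; exists n.
  by apply: bigcup_measurable => n _; exact: mE.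
have UG : \bigcup_N G N = [set u | exists n, (1 <= n)%N /\ a * n%:R <= visits B
  n u].
  rewrite eqEsubset; split=> u; first by move=> [N _ [n [/andP[n1 _] nu]]];
    exists n.
  by move=> [n [n1 nu]]; exists n => //; exists n; rewrite n1 leqnn.
have cG : mu (G N) @[N --> \oo] --> 1%E.
  rewrite -E1 -UG; apply: nondecreasing_cvg_mu => //.
    exact: bigcup_measurable.
  move=> m n mn; apply/subsetPset => u [i [/andP[i1 im] iu]].
  by exists i; rewrite i1 (leq_trans im).
have key N : a <= b + fine (mu (~` G N)).
  set d := fine _.
  have mD : measurable (~` G N) by exact: measurableC.
  have le L : a * (L%:R - N%:R) <= L%:R * (b + d).
    have [LN|NL] := leqP L N.
      apply: (@le_trans _ _ 0); last by rewrite mulr_ge0// addr_ge0// fine_ge0.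
      by rewrite mulr_ge0_le0// subr_le0 ler_nat.
    rewrite [leRHS]mulrDr -lee_fin EFinD /b /d -!integral_visits//.
    rewrite -ge0_integralD//; last 4 first.
    - by move=> u _; rewrite lee_fin visits_ge0.
    - by apply/measurable_EFinP; exact: visits_measurable.
    - by move=> u _; rewrite lee_fin visits_ge0.
    - by apply/measurable_EFinP; exact: visits_measurable.
    have -> : (a * (L%:R - N%:R))%:E =
        (\int[mu]_u (cst (a * (L%:R - N%:R))%:E u))%E.
      by rewrite integral_cst//= probability_setT mule1.
    apply: ge0_le_integral => //=.
    - move=> u _; rewrite lee_fin mulr_ge0// subr_ge0 ler_nat.
      exact: ltnW.
    - apply: emeasurable_funD; apply/measurable_EFinP; exact: visits_measurable.
    - move=> u _; rewrite -EFinD lee_fin (@visits_covering a N B (~` G N))//.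
        by rewrite a0 a1.
      by move=> v /contrapT[n nv]; exists n.
  rewrite leNgt; apply/negP => ab.
  have abd : 0 < a - (b + d) by rewrite subr_gt0.
  have := le (Num.bound (a * N%:R / (a - (b + d)))).
  set L := Num.bound _ => leL.
  have : a * N%:R / (a - (b + d)) < L%:R.
    apply: archi_boundP; apply: divr_ge0; last exact: ltW.
    exact: mulr_ge0.
  by rewrite ltr_pdivrMr//; lra.
have {}key N : (mu (G N) <= (1 - (a - b))%:E)%E.
  have := key N; rewrite probability_setC// -[mu (G N)]fineK ?fin_num_measure//.
  by rewrite -EFinB/= lee_fin; lra.
have : (1%E <= (1 - (a - b))%:E :> \bar R)%E.
  rewrite -(cvg_lim _ cG)//; apply: lime_le; first by apply/cvg_ex; exists 1%E.
  exact: nearW.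
by rewrite lee_fin; lra.
Qed.
End birkhoff.

Section ergodic_frequencies.
Context {R : realType} {U : pfinType}.
Variable mu : probability (borel (seqspace U)) R.
Hypotheses (mu_stationary : stationary mu) (mu_ergodic : ergodic mu).
Implicit Types (B : set (borel (seqspace U))) (u : seqspace U).

(** Unboundedness above of visits minus a linear function is an exactly
    shift-invariant event, since passing from u to its shift changes these
    differences by a bounded amount. By ergodicity it is null or full, and it
    is not full because frequency_le_measure would then give a <= mu B. *)
Lemma visits_bounded (a : R) B : measurable B -> fine (mu B) < a ->
  {ae mu, forall u, exists K : nat, forall n, visits B n u - a * n%:R <= K%:R}.
Proof.
move=> mB Ba.
have a0 : 0 <= a by rewrite (le_trans _ (ltW Ba))// fine_ge0.
pose F n K := [set u : borel (seqspace U) | K%:R < visits B n u - a * n%:R].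
pose E := \bigcap_(K : nat) \bigcup_(n : nat) F n K.
have mF n K : measurable (F n K).
  rewrite (_ : F n K = visits B n @^-1` `]K%:R + a * n%:R, +oo[%classic).
    by rewrite -[X in measurable X]setTI; exact: visits_measurable.
  by rewrite eqEsubset; split=> u; rewrite /F/= in_itv/= andbT ltrBrDr.
have mE : measurable E.
  by apply: bigcap_measurable => // K _; exact: bigcup_measurable.
have TE : left_shift @^-1` E = E.
  rewrite eqEsubset; split=> u Eu K _.
    have [n _] := Eu (K + Num.bound a)%N I.
    rewrite /F/= natrD => h; exists n.+1 => //; rewrite /F/= visitsS -natr1.
    have := archi_boundP a0; have : 0 <= \1_B u :> R by rewrite indicE.
    by lra.
  have [[|n] _] := Eu K.+1 I; rewrite /F/=.
    by rewrite /visits big_ord0 mulr0 subr0 ltrn0.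
  rewrite visitsS -!natr1 => h; exists n => //; rewrite /F/=.
  have : \1_B u <= 1 :> R by rewrite indicE lern1 leq_b1.
  by lra.
have [E0|E1] := mu_ergodic mE TE.
  exists E; split => // u /= Eu K _; apply: contrapT => nF.
  apply: Eu; exists K => n; rewrite leNgt; apply/negP => h.
  by apply: nF; exists n.
exfalso; move: Ba; apply/negP; rewrite -leNgt.
apply: (frequency_le_measure mu_stationary mB).
rewrite (_ : [set _ | _] =
    \bigcup_(n in [set n | (1 <= n)%N]) [set u | a * n%:R <= visits B n u]);
  last by rewrite eqEsubset; split=> u [n [n1 nu]]; exists n.
set G := \bigcup_(n in _) _.
have mG : measurable G.
  apply: bigcup_measurable => n _.
  rewrite (_ : [set _ | _] = visits B n @^-1` `[a * n%:R, +oo[%classic).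
    by rewrite -[X in measurable X]setTI; exact: visits_measurable.
  by rewrite eqEsubset; split=> u /=; rewrite in_itv/= andbT.
apply/eqP; rewrite eq_le probability_le1//= -E1.
apply: le_measure; rewrite ?inE// => u Eu.
have [[|n] _] := Eu 0%N I; rewrite /F/=.
  by rewrite /visits big_ord0 mulr0 subr0 ltxx.
by rewrite subr_gt0 => /ltW h; exists n.+1.
Qed.

(** Birkhoff's theorem for indicators: visits_bounded, applied to B and to its
    complement with thresholds decreasing to their measures, controls the
    frequencies from above and from below. *)
Lemma frequency_cvg B : measurable B ->
  {ae mu, forall u, visits B n u / n%:R @[n --> \oo] --> fine (mu B)}.
Proof.
move=> mB; set b := fine (mu B).
have up : {ae mu, forall u, forall j : nat, exists K : nat,
    forall n, visits B n u - (b + j.+1%:R^-1) * n%:R <= K%:R}.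
  by apply/ae_foralln => j; apply: visits_bounded => //; rewrite ltrDl invr_gt0.
have lo : {ae mu, forall u, forall j : nat, exists K : nat,
    forall n, visits (~` B) n u - (1 - b + j.+1%:R^-1) * n%:R <= K%:R}.
  apply/ae_foralln => j; apply: visits_bounded; first exact: measurableC.
  rewrite probability_setC// -[mu B]fineK ?fin_num_measure//.
  by rewrite -EFinB/= ltrDl invr_gt0.
move: up lo.
apply: (@filterS2 _ _ (ae_filter_ringOfSetsType mu)) => u up lo.
apply/cvgrPdist_le => e e0.
have [j je] : exists j : nat, j.+1%:R^-1 <= e / 2.
  exists (Num.bound (2 / e)); rewrite -[leRHS]invrK lef_pV2 ?posrE//.
    by rewrite invf_div (le_trans (ltW (archi_boundP _)))// ?ler_nat//
      divr_ge0// ltW.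
  by rewrite invr_gt0 divr_gt0.
have [K1 h1] := up j; have [K2 h2] := lo j.
pose K : R := K1%:R + K2%:R.
exists (Num.bound (K * 2 / e)).+1 => // n /= Nn.
have n0 : 0 < n%:R :> R by rewrite ltr0n (leq_trans _ Nn).
have Kn : K <= e / 2 * n%:R.
  have K0 : 0 <= K * 2 / e by rewrite divr_ge0 ?mulr_ge0 ?addr_ge0// ltW.
  have : K * 2 / e < n%:R by rewrite (lt_trans (archi_boundP K0))// ltr_nat.
  by rewrite ltr_pdivrMr//; lra.
have jn : j.+1%:R^-1 * n%:R <= e / 2 * n%:R :> R by rewrite ler_pM2r.
have := h1 n; have := h2 n; rewrite visitsC => {}h2 {}h1.
have K1K : K1%:R <= K by rewrite lerDl.
have K2K : K2%:R <= K by rewrite lerDr.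
move: h1 h2 jn K1K K2K Kn; rewrite distrC ler_distl ler_pdivlMr// ler_pdivrMr//.
move: (j.+1%:R^-1) (K1%:R) (K2%:R) (n%:R) (visits B n u) => J k1 k2 x v.
move=> h1 h2 jn K1K K2K Kn; apply/andP; split; lra.
Qed.

End ergodic_frequencies.

(** * Empirical word frequencies *)

Section word_frequencies.
Context {R : realType} {U : pfinType}.
Variable mu : probability (borel (seqspace U)) R.
Implicit Types (u : borel (seqspace U)).

Lemma empirical_visits k n (w : k.-tuple U) u :
  fine (empirical R U k n u [set w]) =
  visits (cylinder w) (n - k).+1 u / (n - k).+1%:R.
Proof.
rewrite empirical_set1/= mulrC; congr (_ / _); apply: eq_bigr => l _.
rewrite indicE window_iter; congr (nat_of_bool _)%:R.
apply/eqP/idP => [->|/set_mem]; last by rewrite -window_cylinder => ->.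
by apply/mem_set; rewrite -window_cylinder.
Qed.

(** Twice the total variation distance between the empirical and the true law
    of words of length k. *)
Definition word_dist k n u : R :=
  \sum_(w : k.-tuple U)
    `|fine (empirical R U k n u [set w]) - fine (mu (cylinder w))|.

Lemma word_dist_measurable k n : measurable_fun setT (word_dist k n).
Proof.
move=> _ Y _; rewrite setTI.
apply: (@of_level_measurable U (n - k + k).+1) => u v uv; rewrite /=.
suff -> : word_dist k n u = word_dist k n v by [].
apply: eq_bigr => w _; congr (`|_ - _|); rewrite !empirical_set1/=.
congr (_ * _); apply: eq_bigr => l _; congr (nat_of_bool (_ == _))%:R.
apply/eq_from_tnth => i; rewrite !tnth_mktuple.
have lk : (l + i < (n - k + k).+1)%N.
  by rewrite ltnS leq_add// ?(ltnW (ltn_ord i))// -ltnS ltn_ord.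
by have /mkseq_eqP/(_ _ lk) := uv.
Qed.

Hypotheses (mu_stationary : stationary mu) (mu_ergodic : ergodic mu).

Lemma word_dist_cvg k :
  {ae mu, forall u, word_dist k n u @[n --> \oo] --> 0}.
Proof.
have h : {ae mu, forall u, forall m : nat, forall w : seq U,
    unpickle m = Some w ->
    visits (cylinder w) n u / n%:R @[n --> \oo] --> fine (mu (cylinder w))}.
  apply/ae_foralln => m.
  have := @frequency_cvg _ _ _ mu_stationary mu_ergodic
    (cylinder (odflt [::] (unpickle m))) (cylinder_measurable _).
  apply: (@filterS _ _ (ae_filter_ringOfSetsType mu)) => u uw w mw.
  by rewrite mw in uw.
apply: (@filterS _ _ (ae_filter_ringOfSetsType mu)) h => u uw.
rewrite -[X in _ --> X](_ : \sum_(w : k.-tuple U) 0 = 0); last by rewrite big1.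
apply: cvg_big => [|w _]; first exact: add_continuous.
rewrite -(normr0 R) -(subrr (fine (mu (cylinder w)))).
apply: cvg_norm; apply: cvgB; last exact: cvg_cst.
under eq_fun do rewrite empirical_visits.
have nk : (n - k).+1 @[n --> \oo] --> \oo.
  by under eq_fun do rewrite -addn1; apply: cvg_comp (cvg_addnr 1%N);
    exact: cvg_subnr.
exact: (cvg_comp _ _ nk (uw (pickle (w : seq U)) w (pickleK _))).
Qed.

(** Egorov's theorem makes the convergence uniform in the point outside sets of
    summable measure, so deterministic waiting times suffice. *)
Lemma waiting_times : exists N : nat -> nat,
  {ae mu, forall u, \forall k \near \oo, forall n, (N k <= n)%N ->
     word_dist k n u <= k.+1%:R^-1}.
Proof.
have step k : exists BN : set (borel (seqspace U)) * nat,
    [/\ measurable BN.1, (mu BN.1 <= (1 / (2 ^ k.+1)%:R)%:E)%E &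
     forall n u, (BN.2 <= n)%N -> ~ BN.1 u -> word_dist k n u <= k.+1%:R^-1].
  have e0 : 0 < 1 / (2 ^ k.+1)%:R :> R by rewrite divr_gt0// ltr0n expn_gt0.
  have [|||B [mB muB BU]] := @ae_pointwise_almost_uniform _ R _ mu (word_dist k)
    (cst 0) setT _ (word_dist_measurable k) _ measurableT _ _ e0.
  - exact: measurable_cst.
  - exact: le_lt_trans (probability_le1 mu measurableT) (ltry 1).
  - apply: (@filterS _ _ (ae_filter_ringOfSetsType mu)) (word_dist_cvg k).
    by move=> u uk _.
  have k0 : 0 < k.+1%:R^-1 :> R by rewrite invr_gt0.
  have : \forall n \near \oo, forall u, ([set: borel (seqspace U)] `\` B) u ->
      ball (0 : R) (PosNum k0)%:num (word_dist k n u).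
    apply: (BU [set f | forall u, ([set: borel (seqspace U)] `\` B) u ->
      ball (0 : R) (PosNum k0)%:num (f u)]); apply/uniform_nbhs.
    by exists [set xy | ball xy.1 (PosNum k0)%:num xy.2]; split;
      [exact: entourage_ball|].
  move=> [N _ BN]; exists (B, N); split=> //=; first exact: ltW.
  move=> n u Nn Bu; have := BN n Nn u (conj I Bu).
  by rewrite /ball/= sub0r normrN => /ltW; apply: le_trans; exact: ler_norm.
have [BN BNP] := choice step.
exists (fun k => (BN k).2).
exists (lim_sup_set (fun k => (BN k).1)); split.
- apply: bigcap_measurable => // m _; apply: bigcup_measurable => k _.
  by have [] := BNP k.
- apply: lim_sup_set_cvg0 => [k|]; first by have [] := BNP k.
  apply: (@le_lt_trans _ _ 1%:E); last exact: ltry.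
  apply: le_trans (epsilon_trick0 xpredT (@ler01 R)).
  by apply: lee_nneseries => // k _; have [] := BNP k.
- move=> u /= uN m _; apply: contrapT => um; apply: uN.
  exists m => // k /= mk n Nn; have [_ _ h] := BNP k; apply: h => // Bu.
  by apply: um; exists k.
Qed.

End word_frequencies.

(** * Choice of the block lengths *)

(** The block length is the largest k whose waiting time has passed. *)
Lemma slow_block_lengths (N : nat -> nat) : exists k : nat -> nat,
  [/\ forall n, (1 <= k n)%N, forall n, (1 <= n)%N -> (k n <= n)%N,
      k @ \oo --> \oo & \forall n \near \oo, (N (k n) <= n)%N].
Proof.
pose k0 n := (\max_(i < n.+1 | (N i <= n)%N) i)%N.
pose k n := maxn 1 (k0 n).
have k0_ge m n : (m <= n)%N -> (N m <= n)%N -> (m <= k0 n)%N.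
  move=> mn Nm; rewrite -[m]/(val (Ordinal (mn : (m < n.+1)%N))).
  exact: (@leq_bigmax_cond _ _ (fun i : 'I_n.+1 => nat_of_ord i)).
have k0P n : k0 n = 0%N \/ ((k0 n <= n)%N /\ (N (k0 n) <= n)%N).
  rewrite /k0; elim/big_ind: _; first by left.
    by move=> a b; rewrite /maxn; case: ifP.
  by move=> i Ni; right; split => //; rewrite -ltnS.
exists k; split.
- by move=> n; exact: leq_maxl.
- by move=> n n1; rewrite geq_max n1/=; have [->|[]] := k0P n.
- apply/cvgnyPge => m; exists (maxn m (N m)) => // n /=.
  rewrite geq_max => /andP[mn Nm]; rewrite /k leq_max.
  by rewrite k0_ge// orbT.
- exists (maxn 1 (N 1)) => // n /=; rewrite geq_max => /andP[n1 Nn].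
  have k1 := k0_ge _ _ n1 Nn; rewrite /k (maxn_idPr k1).
  by have [k0n|[]//] := k0P n; rewrite k0n in k1.
Qed.

Lemma ae_measurable_full d (T : measurableType d) (R : realType)
    (P : probability T R) (Q : T -> Prop) : {ae P, forall x, Q x} ->
  exists A : set T, [/\ measurable A, P A = 1%E & A `<=` Q].
Proof.
move=> [B [mB B0 QB]]; exists (~` B); split; first exact: measurableC.
  by rewrite probability_setC// B0 sube0.
by move=> x Bx; apply: contrapT => Qx; exact/Bx/QB.
Qed.

Lemma word_dist_diagonal (R : realType) (U : pfinType)
    (mu : probability (borel (seqspace U)) R) (N k : nat -> nat) u :
  k @ \oo --> \oo -> (\forall n \near \oo, (N (k n) <= n)%N) ->
  (\forall m \near \oo, forall n, (N m <= n)%N ->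
     word_dist mu m n u <= m.+1%:R^-1) ->
  word_dist mu (k n) n u @[n --> \oo] --> 0.
Proof.
move=> koo Nk uN.
have h1 : \forall n \near \oo, word_dist mu (k n) n u <= (k n).+1%:R^-1.
  have kN : \forall n \near \oo, forall i, (N (k n) <= i)%N ->
    word_dist mu (k n) i u <= (k n).+1%:R^-1 := koo _ uN.
  by apply: filterS2 kN Nk => n; exact.
have h2 : (k n).+1%:R^-1 @[n --> \oo] --> (0 : R).
  exact: (cvg_comp _ _ koo cvg_harmonic).
apply: (@squeeze_cvgr _ _ _ _ (fun=> 0) (fun n => (k n).+1%:R^-1)) => //.
  by apply: filterS h1 => n ->; rewrite andbT; apply: sumr_ge0.
exact: cvg_cst.
Qed.

Lemma good_block_lengths (R : realType) (X Y : pfinType)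
    (mu : probability (borel (seqspace X)) R)
    (nu : probability (borel (seqspace Y)) R) :
  stationary mu -> stationary nu -> ergodic mu -> ergodic nu ->
  exists k : nat -> nat, exists (A : set (borel (seqspace X)))
      (B : set (borel (seqspace Y))),
    [/\ forall n, (1 <= k n)%N, forall n, (1 <= n)%N -> (k n <= n)%N,
        k @ \oo --> \oo,
        [/\ measurable A, mu A = 1%E, measurable B & nu B = 1%E] &
        (forall x, A x -> word_dist mu (k n) n x @[n --> \oo] --> 0) /\
        (forall y, B y -> word_dist nu (k n) n y @[n --> \oo] --> 0)].
Proof.
move=> smu snu emu enu.
have [N1 /ae_measurable_full[A [mA A1 AN]]] := waiting_times smu emu.
have [N2 /ae_measurable_full[B [mB B1 BN]]] := waiting_times snu enu.
have [k [k1 kn koo Nk]] := slow_block_lengths (fun m => maxn (N1 m) (N2 m)).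
exists k, A, B; split => //; split => x.
  move/AN; apply: word_dist_diagonal => //.
  by apply: filterS Nk => n; rewrite geq_max => /andP[].
move/BN; apply: word_dist_diagonal => //.
by apply: filterS Nk => n; rewrite geq_max => /andP[].
Qed.

(** * Couplings of finite distributions *)

Section finite_couplings.
Context {R : realType} {Z I J : finType}.
Variables (p : Z -> I) (q : Z -> J) (pair : I -> J -> Z).
Hypotheses (p_pair : forall i j, p (pair i j) = i)
  (q_pair : forall i j, q (pair i j) = j)
  (pairK : forall z, pair (p z) (q z) = z).
Implicit Types (a : I -> R) (b : J -> R) (w : Z -> R).

Lemma sum_fiber_fst (f : Z -> R) i :
  \sum_(z | p z == i) f z = \sum_j f (pair i j).
Proof.
rewrite (reindex_onto (pair i) q) => [|z /eqP <-]; last exact: pairK.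
by apply: eq_bigl => j; rewrite p_pair q_pair !eqxx.
Qed.

Lemma sum_fiber_snd (f : Z -> R) j :
  \sum_(z | q z == j) f z = \sum_i f (pair i j).
Proof.
rewrite (reindex_onto (pair^~ j) p) => [|z /eqP <-]; last exact: pairK.
by apply: eq_bigl => i; rewrite p_pair q_pair !eqxx.
Qed.

Definition pmf_coupling a b w :=
  [/\ forall z, 0 <= w z, forall i, \sum_(z | p z == i) w z = a i &
      forall j, \sum_(z | q z == j) w z = b j].

(** The missing mass r is distributed as the normalised product of the missing
    marginals; when r = 0 the convention 0^-1 = 0 is harmless because then the
    missing marginals vanish. *)
Lemma complete_coupling a b w0 :
  \sum_i a i = 1 -> \sum_j b j = 1 -> (forall z, 0 <= w0 z) ->
  (forall i, \sum_(z | p z == i) w0 z <= a i) ->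
  (forall j, \sum_(z | q z == j) w0 z <= b j) ->
  exists w, [/\ pmf_coupling a b w, forall z, w0 z <= w z &
    \sum_z (w z - w0 z) = 1 - \sum_z w0 z].
Proof.
move=> a1 b1 w00 w0a w0b.
pose a' i := a i - \sum_(z | p z == i) w0 z.
pose b' j := b j - \sum_(z | q z == j) w0 z.
pose r := 1 - \sum_z w0 z.
have a'0 i : 0 <= a' i by rewrite subr_ge0.
have b'0 j : 0 <= b' j by rewrite subr_ge0.
have ra : \sum_i a' i = r.
  by rewrite sumrB a1 /r (partition_big p xpredT).
have rb : \sum_j b' j = r.
  by rewrite sumrB b1 /r (partition_big q xpredT).
have r0 : 0 <= r by rewrite -ra sumr_ge0.
have a'r i : a' i * (r / r) = a' i.
  have [r_0|rn0] := eqVneq r 0; last by rewrite divff// mulr1.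
  suff -> : a' i = 0 by rewrite mul0r.
  apply/eqP; rewrite eq_le a'0 andbT -r_0 -ra (bigD1 i)//= lerDl.
  exact: sumr_ge0.
have b'r j : b' j * (r / r) = b' j.
  have [r_0|rn0] := eqVneq r 0; last by rewrite divff// mulr1.
  suff -> : b' j = 0 by rewrite mul0r.
  apply/eqP; rewrite eq_le b'0 andbT -r_0 -rb (bigD1 j)//= lerDl.
  exact: sumr_ge0.
pose w1 z := a' (p z) * b' (q z) / r.
have w10 z : 0 <= w1 z by rewrite divr_ge0 ?mulr_ge0.
have w1a i : \sum_(z | p z == i) w1 z = a' i.
  rewrite sum_fiber_fst /w1; under eq_bigr do rewrite p_pair q_pair -mulrA.
  by rewrite -mulr_sumr -mulr_suml rb a'r.
have w1b j : \sum_(z | q z == j) w1 z = b' j.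
  rewrite sum_fiber_snd /w1.
  under eq_bigr do rewrite p_pair q_pair -mulrA.
  by rewrite -mulr_suml ra mulrCA b'r.
exists (fun z => w0 z + w1 z); split; last 2 first.
- by move=> z; rewrite lerDl.
- under eq_bigr do rewrite addrC addKr.
  by rewrite (partition_big p xpredT)//= (eq_bigr a')// => i _; rewrite w1a.
split => [z|i|j]; first by rewrite addr_ge0.
  by rewrite big_split/= w1a /a' addrC subrK.
by rewrite big_split/= w1b /b' addrC subrK.
Qed.

Lemma coupling_exists a b : (forall i, 0 <= a i) -> (forall j, 0 <= b j) ->
  \sum_i a i = 1 -> \sum_j b j = 1 -> exists w, pmf_coupling a b w.
Proof.
move=> a0 b0 a1 b1.
have [|||w [wab _ _]] := @complete_coupling a b (fun=> 0) a1 b1.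
- by [].
- by move=> i; rewrite big1.
- by move=> j; rewrite big1.
by exists w.
Qed.

(** Couplings depend continuously on their marginals: thinning a coupling of a1
    and b1 by the factors min(a,a1)/a1 and min(b,b1)/b1 leaves a sub-coupling
    of a and b whose missing mass is controlled by the distances. *)
Lemma perturb_coupling (d : Z -> R) (M : R) a b a1 b1 w1 :
  (forall z, 0 <= d z <= M) -> (forall i, 0 <= a i) -> (forall j, 0 <= b j) ->
  \sum_i a i = 1 -> \sum_j b j = 1 -> \sum_i a1 i = 1 ->
  pmf_coupling a1 b1 w1 ->
  exists2 w, pmf_coupling a b w &
    \sum_z d z * w z <= \sum_z d z * w1 z +
      M * (\sum_i `|a i - a1 i| + \sum_j `|b j - b1 j|).
Proof.
move=> dM a0 b0 sa sb sa1 [w10 w1a w1b].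
have a10 i : 0 <= a1 i by rewrite -w1a sumr_ge0.
have b10 j : 0 <= b1 j by rewrite -w1b sumr_ge0.
have sw1 : \sum_z w1 z = 1.
  by rewrite -sa1 (partition_big p xpredT)//=; apply: eq_bigr => i _.
pose rho (s t : R) := Num.min s t / t.
have rho01 s t : 0 <= s -> 0 <= t -> 0 <= rho s t <= 1.
  move=> s0 t0; have [->|tn0] := eqVneq t 0.
    by rewrite /rho invr0 mulr0 lexx ler01.
  have tp : 0 < t by rewrite lt_def tn0.
  by rewrite /rho divr_ge0 ?le_min ?s0//= ler_pdivrMr// mul1r ge_min lexx orbT.
have rho_le s t : 0 <= s -> 0 <= t -> t * rho s t <= s.
  move=> s0 t0; have [->|tn0] := eqVneq t 0; first by rewrite mul0r.
  by rewrite /rho mulrC divfK// ge_min lexx.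
have rhoB s t : 0 <= s -> 0 <= t -> t * (1 - rho s t) <= `|s - t|.
  move=> s0 t0; have [->|tn0] := eqVneq t 0; first by rewrite mul0r.
  rewrite mulrBr mulr1 /rho [t * _]mulrC divfK//.
  have [st|ts] := leP s t; first by rewrite distrC ler_norm.
  by rewrite subrr.
pose al i := rho (a i) (a1 i); pose be j := rho (b j) (b1 j).
have al01 i : 0 <= al i <= 1 by exact: rho01.
have be01 j : 0 <= be j <= 1 by exact: rho01.
pose w0 z := w1 z * al (p z) * be (q z).
have w00 z : 0 <= w0 z.
  have /andP[? _] := al01 (p z); have /andP[? _] := be01 (q z).
  by apply: mulr_ge0 => //; apply: mulr_ge0.
have w0al z : w0 z <= w1 z * al (p z).
  have /andP[? _] := al01 (p z); have /andP[_ ?] := be01 (q z).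
  by rewrite ler_piMr// mulr_ge0.
have w0be z : w0 z <= w1 z * be (q z).
  have /andP[? ?] := al01 (p z); have /andP[? _] := be01 (q z).
  by rewrite /w0 -mulrA ler_wpM2l// ler_piMl.
have w0w1 z : w0 z <= w1 z.
  by apply: le_trans (w0al z) _; have /andP[_ ?] := al01 (p z);
    rewrite ler_piMr.
have [||w [wab ww0 sw]] := @complete_coupling a b w0 sa sb w00.
- move=> i; apply: le_trans (rho_le (a i) (a1 i) (a0 i) (a10 i)).
  rewrite -w1a mulr_suml; apply: ler_sum => z /eqP <-; rewrite w1a; exact: w0al.
- move=> j; apply: le_trans (rho_le (b j) (b1 j) (b0 j) (b10 j)).
  rewrite -w1b mulr_suml; apply: ler_sum => z /eqP <-; rewrite w1b; exact: w0be.
exists w => //.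
have -> : \sum_z d z * w z = \sum_z d z * w0 z + \sum_z d z * (w z - w0 z).
  by rewrite -big_split/=; apply: eq_bigr => z _; rewrite -mulrDr addrC subrK.
apply: lerD.
  by apply: ler_sum => z _; have /andP[? _] := dM z; rewrite ler_wpM2l.
apply: (@le_trans _ _ (M * (1 - \sum_z w0 z))).
  rewrite -sw mulr_sumr; apply: ler_sum => z _; have /andP[_ ?] := dM z.
  by rewrite ler_wpM2r// subr_ge0.
have M0 : 0 <= M \/ forall z : Z, False.
  case: (pickP (fun _ : Z => true)) => [z _|no]; last by right => z;
    have := no z.
  by left; have /andP[h1 h2] := dM z; exact: le_trans h2.
case: M0 => [M0|no]; last first.
  by move: sw1; rewrite big1 => [/eqP|z];
    [rewrite eq_sym oner_eq0|case: (no z)].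
rewrite ler_wpM2l// -sw1 -sumrB.
apply: (@le_trans _ _ (\sum_z w1 z * (1 - al (p z)) + \sum_z w1 z * (1 - be (q
  z)))).
  rewrite -big_split/=; apply: ler_sum => z _; rewrite /w0.
  have /andP[? ?] := al01 (p z); have /andP[? ?] := be01 (q z); have := w10 z.
  rewrite -subr_ge0 => w1z.
  have -> : w1 z * (1 - al (p z)) + w1 z * (1 - be (q z)) -
     (w1 z - w1 z * al (p z) * be (q z)) =
     w1 z * ((1 - al (p z)) * (1 - be (q z))) by ring.
  by apply: mulr_ge0 => //; apply: mulr_ge0; rewrite subr_ge0.
rewrite (partition_big p xpredT)//= [X in _ + X](partition_big q xpredT)//=.
apply: lerD; apply: ler_sum => i _.
  rewrite (eq_bigr (fun z => w1 z * (1 - al i))); last by move=> z /eqP ->.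
  by rewrite -mulr_suml w1a rhoB.
rewrite (eq_bigr (fun z => w1 z * (1 - be i))); last by move=> z /eqP ->.
by rewrite -mulr_suml w1b rhoB.
Qed.

End finite_couplings.

(** * Weak compactness through cylinders *)

(** A countable product of unit intervals is compact, so the sequence has a
    cluster point; the j-th term extracted is close to it in the first j
    coordinates. *)
Lemma diagonal_extraction (R : realType) (I : countType) (a : nat -> I -> R) :
  (forall n i, 0 <= a n i <= 1) ->
  exists t : nat -> nat, {homo t : m n / (m < n)%N} /\
    exists L : I -> R, forall i, a (t n) i @[n --> \oo] --> L i.
Proof.
move=> a01.
pose b n : prod_topology (fun _ : nat => R) :=
  (* indices that code no element of I get the constant 0 *)
  fun m => if unpickle m is Some i then a n i else 0.
have Kc := @tychonoff nat (fun=> R) (fun=> `[0, 1]%classic) (fun=>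
  @segment_compact R 0 1).
have bK n : [set f : prod_topology (fun _ : nat => R) |
    forall i, `[0, 1]%classic (f i)] (b n).
  move=> m /=; rewrite in_itv/= /b; case: unpickle => [i|]; first exact: a01.
  by rewrite lexx ler01.
have bF : (b @ \oo) [set f : prod_topology (fun _ : nat => R) |
    forall i, `[0, 1]%classic (f i)] by exists 0%N => // n _; exact: bK.
have [L [_ clL]] := Kc (b @ \oo) (fmap_proper_filter b eventually_filter) bF.
pose V j := [set f : prod_topology (fun _ : nat => R) |
  forall i, (i < j)%N -> `|L i - f i| < j%:R^-1].
have nV j : nbhs L (V j).
  have FF : Filter (nbhs L) by exact: (@nbhs_filter (prod_topology (fun _ : nat
    => R))).
  have [->|j0] := posnP j; first by apply: (filterS _ (@filterT _ _ FF)).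
  have e0 : 0 < j%:R^-1 :> R by rewrite invr_gt0 ltr0n.
  suff H m : nbhs L [set f : prod_topology (fun _ : nat => R) |
      forall i, (i < m)%N -> `|L i - f i| < j%:R^-1] by exact: H.
  elim: m => [|m IHm]; first by apply: (filterS _ (@filterT _ _ FF)).
  have Lm : nbhs L [set f : prod_topology (fun _ : nat => R) | `|L m - f m| <
    j%:R^-1].
    apply: (@proj_continuous nat (fun=> R) m L (ball (L m) j%:R^-1)).
    exact: nbhsx_ballx.
  apply: filterS (filterI IHm Lm) => f [h1 h2] i.
  by rewrite ltnS leq_eqVlt => /predU1P[->//|]; exact: h1.
have pick m j : exists n, (m <= n)%N /\ V j (b n).
  have : (b @ \oo) [set f | exists2 n, (m <= n)%N & f = b n].
    by exists m => // n /= mn; exists n.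
  move=> /clL /(_ (nV j))[_ [[n mn ->] Vn]].
  by exists n.
have [F FP] := choice (fun mj => pick mj.1 mj.2).
pose t := fix t j := if j is j'.+1 then F ((t j').+1, j) else F (0%N, 0%N).
have tS j : (t j < t j.+1)%N by have [] := FP ((t j).+1, j.+1).
have tV j : V j (b (t j)).
  by case: j => [|j]; [have [] := FP (0, 0)%N|have [] := FP ((t j).+1, j.+1)].
exists t; split; first by apply: homo_ltn tS; exact: ltn_trans.
exists (fun i => L (pickle i)) => i; apply/cvgrPdist_lt => e e0.
exists (maxn (pickle i).+1 (Num.bound e^-1)) => // n /=.
rewrite geq_max => /andP[ni ne].
have := tV n (pickle i) ni; rewrite /b pickleK => /lt_le_trans; apply.
have ei : 0 <= e^-1 by rewrite invr_ge0 ltW.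
have n0 : 0 < n%:R :> R by rewrite ltr0n (leq_trans _ ni).
rewrite -[leRHS]invrK lef_pV2 ?posrE ?invr_gt0//.
by rewrite (le_trans (ltW (archi_boundP ei)))// ler_nat.
Qed.

Section cylinder_convergence.
Context {R : realType} {U : pfinType}.
Implicit Types (mu : {measure set borel (seqspace U) -> \bar R}).

Lemma continuous_borel_measurable (f : seqspace U -> R) :
  continuous f -> measurable_fun setT (f : borel (seqspace U) -> R).
Proof.
move=> cf; apply: (@measurability _ _ _ _ _ _ (@RGenOInfty.G R)).
  exact: RGenOInfty.measurableE.
move=> _ [_ [x ->] <-]; rewrite setTI; apply: open_measurable_borel.
move/continuousP : cf; apply; rewrite set_itvE; exact: open_gt.
Qed.

Lemma measure1_fin_num mu (A : set (borel (seqspace U))) :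
  mu setT = 1%E -> measurable A -> mu A \is a fin_num.
Proof.
move=> mu1 mA; rewrite ge0_fin_numE//.
apply: (@le_lt_trans _ _ 1%E); last exact: ltry.
by rewrite -mu1; apply: le_measure; rewrite ?inE.
Qed.

Lemma measure1_level mu m (A : set (borel (seqspace U))) :
  mu setT = 1%E -> of_level m A ->
  fine (mu A) = \sum_(w : m.-tuple U | extend w \in A) fine (mu (cylinder w)).
Proof.
move=> mu1 lA; rewrite (level_decomp mu lA) sum_fine// => w _.
by apply: measure1_fin_num => //; exact: cylinder_measurable.
Qed.

(** Continuous functions are uniformly close to functions of a prefix, so their
    integrals are determined by the cylinders up to a small error. *)
Lemma integral_prefix_approx mu (f : seqspace U -> R) m (e : R) :
  mu setT = 1%E -> continuous f -> bounded_fun f ->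
  (forall u v, mkseq u m = mkseq v m -> `|f u - f v| <= e) ->
  (\int[mu]_u (f u)%:E \is a fin_num)%E /\
  `|fine (\int[mu]_u (f u)%:E)%E -
    \sum_(w : m.-tuple U) f (extend w) * fine (mu (cylinder w))| <= e.
Proof.
move=> mu1 cf bf fe.
have muT : (mu setT < +oo)%E by rewrite mu1 ltry.
have mf := continuous_borel_measurable cf.
have intf : mu.-integrable setT (EFin \o (f : borel (seqspace U) -> R)).
  exact: measurable_bounded_integrable.
have finf := integrable_fin_num measurableT intf.
split => //.
have e0 : 0 <= e by have := fe point point erefl; rewrite subrr normr0.
have mC (w : seq U) : measurable (cylinder w : set (borel (seqspace U))).
  exact: cylinder_measurable.
have cover : [set: borel (seqspace U)] =
    \big[setU/set0]_(w <- index_enum (m.-tuple U)) cylinder w.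
  rewrite -bigcup_seq eqEsubset; split=> // u _.
  have mu_ : size (mkseq u m) == m by rewrite size_mkseq.
  exists (Tuple mu_); first by rewrite /= mem_index_enum.
  by rewrite /cylinder/= size_mkseq.
have split_int : (\int[mu]_u (f u)%:E)%E =
    (\sum_(w : m.-tuple U) \int[mu]_(u in cylinder w) (f u)%:E)%E.
  rewrite cover (@integral_bigsetU_EFin _ (borel (seqspace U)) R mu _
    (fun w : m.-tuple U => cylinder w))//.
  - exact: index_enum_uniq.
  - move=> w w' _ _ [u [/= uw uw']]; apply/val_inj; rewrite /= -uw -uw'.
    by rewrite !size_tuple.
  - by rewrite -cover; apply/measurable_EFinP.
have int_cyl (w : m.-tuple U) :
    `|fine (\int[mu]_(u in cylinder w) (f u)%:E)%E -
      f (extend w) * fine (mu (cylinder w))| <= e * fine (mu (cylinder w))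
    /\ (\int[mu]_(u in cylinder w) (f u)%:E)%E \is a fin_num.
  have muw : mu (cylinder w) \is a fin_num by exact: measure1_fin_num.
  have muw_oo : (mu (cylinder w) < +oo)%E by rewrite ltey_eq muw.
  have intw : mu.-integrable (cylinder w) (EFin \o (f : borel (seqspace U) ->
    R)).
    exact: integrableS intf.
  have finw := integrable_fin_num (mC w) intw.
  have intc (c : R) : mu.-integrable (cylinder w) (EFin \o cst c).
    apply: measurable_bounded_integrable => //.
    by exists `|c|; split; [exact: num_real|move=> y cy u _; exact: ltW].
  split => //; set c := f (extend w).
  have -> : fine (\int[mu]_(u in cylinder w) (f u)%:E)%E - c * fine (mu
    (cylinder w))
      = fine (\int[mu]_(u in cylinder w) (f u - c)%:E)%E.
    have := integralB_EFin (mC w) intw (intc c).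
    rewrite /= integral_cst// => ->.
    by rewrite -(fineK finw) -(fineK muw) -EFinM -EFinB.
  rewrite -lee_fin -fine_abse; last first.
    exact: (integrable_fin_num (mC w) (integrableB (mC w) intw (intc c))).
  rewrite EFinM (fineK muw) fineK; last first.
    rewrite abse_fin_num.
    exact: (integrable_fin_num (mC w) (integrableB (mC w) intw (intc c))).
  have mfc : measurable_fun (cylinder w : set (borel (seqspace U)))
      (fun u : borel (seqspace U) => (f u - c)%:E).
    apply/measurable_EFinP; apply: measurable_funB => //.
    exact: measurable_funS mf.
  apply: le_trans (le_abse_integral mu (mC w) mfc) _.
  apply: integral_le_bound => //; apply: aeW => u uw.
  rewrite /= lee_fin fe//; move: uw; rewrite /cylinder/= size_tuple => ->.
  by rewrite mkseq_extend_tuple.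
have fine_sum : fine (\int[mu]_u (f u)%:E)%E =
    \sum_(w : m.-tuple U) fine (\int[mu]_(u in cylinder w) (f u)%:E)%E.
  by rewrite split_int sum_fine// => w _; have [] := int_cyl w.
rewrite fine_sum -sumrB (le_trans (ler_norm_sum _ _ _))//.
apply: (@le_trans _ _ (\sum_(w : m.-tuple U) e * fine (mu (cylinder w)))).
  by apply: ler_sum => w _; have [] := int_cyl w.
rewrite -mulr_sumr -[leRHS]mulr1 ler_wpM2l//.
have /esym := @measure1_level mu m setT mu1 (fun _ _ _ _ => I).
rewrite mu1/= => <-; rewrite le_eqVlt; apply/orP; left; apply/eqP.
by apply: eq_bigl => w; rewrite in_setT.
Qed.

Lemma weak_cvg_cylinders
    (la : nat -> {measure set borel (seqspace U) -> \bar R})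
    (P : probability (borel (seqspace U)) R) :
  (forall n, la n setT = 1%E) ->
  (forall w, fine (la n (cylinder w)) @[n --> \oo] --> fine (P (cylinder w))) ->
  weak_cvg la P.
Proof.
move=> la1 laP f cf bf.
have cf' : continuous (f : seqspace U -> R) by [].
have P1 : P setT = 1%E by exact: probability_setT.
have fin0 (mu : {measure set borel (seqspace U) -> \bar R}) : mu setT = 1%E ->
    (\int[mu]_u (f u)%:E \is a fin_num)%E.
  move=> mu1; have [m me] := continuous_prefix cf' ltr01.
  by have [] := integral_prefix_approx mu1 cf' bf me.
rewrite -[X in _ --> X]fineK ?fin0//; apply/fine_cvgP; split.
  by apply: nearW => n; exact: fin0.
apply/cvgrPdist_le => e e0; have e3 : 0 < e / 3 by rewrite divr_gt0.
have [m me] := continuous_prefix cf' e3.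
pose I (mu : {measure set borel (seqspace U) -> \bar R}) :=
  \sum_(w : m.-tuple U) f (extend w) * fine (mu (cylinder w)).
have cI : I (la n) @[n --> \oo] --> I P.
  apply: cvg_big => [|w _]; first exact: add_continuous.
  by apply: cvgMr; exact: laP.
have /cvgrPdist_le/(_ _ e3) nI := cI.
apply: filterS nI => n In.
have [_ h1] := integral_prefix_approx (la1 n) cf' bf me.
have [_ h2] := integral_prefix_approx P1 cf' bf me.
rewrite /=.
move: In h1 h2; rewrite -/(I (la n)) -/(I P) !ler_norml.
move=> /andP[? ?] /andP[? ?] /andP[? ?]; apply/andP; split; lra.
Qed.

Lemma cvg_level (la : nat -> {measure set borel (seqspace U) -> \bar R})
    (P : probability (borel (seqspace U)) R) m (A : set (borel (seqspace U))) :
  (forall n, la n setT = 1%E) -> of_level m A ->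
  (forall w, fine (la n (cylinder w)) @[n --> \oo] --> fine (P (cylinder w))) ->
  fine (la n A) @[n --> \oo] --> fine (P A).
Proof.
move=> la1 lA laP.
rewrite (measure1_level (probability_setT P) lA).
under eq_fun do rewrite (measure1_level (la1 _) lA).
by apply: cvg_big => [|w _]; [exact: add_continuous|exact: laP].
Qed.

Lemma measure_cylinder_rcons mu w :
  mu (cylinder w) = (\sum_(v : U) mu (cylinder (rcons w v)))%E.
Proof.
rewrite -(@measure_finType _ (borel (seqspace U)) R mu U _
  (fun v => cylinder (rcons w v))).
- congr (mu _); rewrite eqEsubset /cylinder; split=> u.
    by move=> /= uw; exists (u (size w)) => //=; rewrite size_rcons mkseqS uw.
  by move=> [v _ /=]; rewrite size_rcons mkseqS => /rcons_inj[].
- by move=> v; exact: cylinder_measurable.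
- move=> v v' _ _ [u [/=]]; rewrite /cylinder/= !size_rcons !mkseqS.
  by move=> /rcons_inj[_ <-] /rcons_inj[_ <-].
Qed.

(** Limits of cylinder probabilities inherit consistency, hence come from a
    probability. *)
Lemma cylinder_compactness
    (la : nat -> {measure set borel (seqspace U) -> \bar R}) :
  (forall n, la n setT = 1%E) ->
  exists t : nat -> nat, {homo t : m n / (m < n)%N} /\
    exists P : probability (borel (seqspace U)) R,
    forall w,
      fine (la (t n) (cylinder w)) @[n --> \oo] --> fine (P (cylinder w)).
Proof.
move=> la1.
have fincyl n (w : seq U) : la n (cylinder w) \is a fin_num.
  by apply: measure1_fin_num => //; exact: cylinder_measurable.
have [|t [tm [L tL]]] :=
  @diagonal_extraction R (seq U) (fun n w => fine (la n (cylinder w))).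
  move=> n w; rewrite fine_ge0//= -lee_fin fineK// -(la1 n).
  by apply: le_measure; rewrite ?inE//; exact: cylinder_measurable.
have [||w|P PL] := @kolmogorov_extension R U L.
- move=> w; apply: (closed_cvg (fun x : R => 0 <= x) _ _ _ (tL w)).
    exact: closed_ge.
  by apply: nearW => n; exact: fine_ge0.
- apply: (cvg_unique _ (tL [::])); first exact: norm_hausdorff.
  apply: cvg_near_cst; apply: nearW => n.
  have -> : cylinder [::] = [set: seqspace U] by rewrite eqEsubset.
  by rewrite la1.
- apply: (cvg_unique _ (tL w)); first exact: norm_hausdorff.
  have : \sum_v fine (la (t n) (cylinder (rcons w v))) @[n --> \oo]
      --> \sum_v L (rcons w v).
    by apply: cvg_big => [|v _]; [exact: add_continuous|exact: tL].
  apply: cvg_trans; apply: near_eq_cvg; apply: nearW => n.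
  by rewrite (measure_cylinder_rcons (la (t n))) sum_fine.
exists t; split => //; exists P => w; rewrite PL; exact: tL.
Qed.

End cylinder_convergence.

(** * Laws of the block process *)

Lemma measure1_window (R : realType) (U : pfinType) k
    (mu : {measure set borel (seqspace U) -> \bar R}) (A : set (k.-tuple U)) :
  mu setT = 1%E ->
  fine (mu (window k 0 @^-1` A)) =
  \sum_(w : k.-tuple U | w \in A) fine (mu (cylinder w)).
Proof.
move=> mu1; rewrite (measure1_level mu1 (@window_level U k 0 A)).
apply: eq_bigl => w; have e : window k 0 (extend w) = w.
  by apply/val_inj; rewrite /= val_window mkseq_extend_tuple.
by apply/idP/idP => /set_mem h; apply/mem_set; move: h; rewrite /= e.
Qed.

Lemma block_measure1 (R : realType) (U : pfinType) k
    (g : probability (borel (blockspace U k)) R) (A : set (k.-tuple U)) :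
  fine (g A) = \sum_(w : k.-tuple U | w \in A) fine (g [set w]).
Proof.
by rewrite (block_measureE g A) sum_fine// => w _; exact: block_fin_num.
Qed.

Section letter_map.
Context {U V : pfinType}.
Variable phi : U -> V.

Definition seq_map (u : seqspace U) : seqspace V := fun i => phi (u i).
Definition block_map k (z : blockspace U k) : blockspace V k :=
  [tuple phi (tnth z i) | i < k].

Lemma seq_map_level m (A : set (seqspace V)) :
  of_level m A -> of_level m (seq_map @^-1` A).
Proof.
move=> lA u v /mkseq_eqP uv; apply: lA; apply/mkseq_eqP => i im.
by rewrite /seq_map uv.
Qed.

Lemma seq_map_measurable : measurable_fun setT
  (seq_map : borel (seqspace U) -> borel (seqspace V)).
Proof.
by apply: measurable_fun_level => m A /seq_map_level;
  exact: of_level_measurable.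
Qed.

Lemma window_seq_map k l (u : seqspace U) :
  window k l (seq_map u) = block_map (window k l u).
Proof. by apply/eq_from_tnth => i; rewrite !tnth_mktuple. Qed.

End letter_map.

Section subwords.
Context {U : pfinType}.

Definition subword_at k l (w : seq U) : set (k.-tuple U) :=
  [set z | take (size w) (drop l z) = w].
Arguments subword_at : clear implicits.

Lemma window_subword_at k l (w : seq U) : (l + size w <= k)%N ->
  window k 0 @^-1` (subword_at k l w) = iter l left_shift @^-1` cylinder w.
Proof.
move=> lk; rewrite eqEsubset /subword_at /cylinder.
suff e (u : seqspace U) :
    take (size w) (drop l (window k 0 u)) = mkseq (iter l left_shift u) (size
      w).
  by split=> u /=; rewrite e.
rewrite val_window /= /mkseq -map_drop -map_take drop_iota take_iota.
have /minn_idPl -> : (size w <= k - l)%N by rewrite leq_subRL ?(leq_trans _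
  lk)// ?leq_addr.
rewrite add0n -[in LHS](addn0 l) iotaDl -map_comp; apply: eq_map => i /=.
by rewrite iter_left_shiftE.
Qed.

End subwords.

Arguments subword_at {U} k l w.

Section block_process_laws.
Context {R : realType} {U : pfinType} {k : nat}.
Hypothesis k_gt0 : (0 < k)%N.
Variable g : probability (borel (blockspace U k)) R.

Let P := iid_block_measure g.

Let first_block (A : set (k.-tuple U)) : P (window k 0 @^-1` A) = g A.
Proof.
have [PB _] := getPex (iid_blocks_nonempty k_gt0 g).
exact: (PB 0%N A (block_measurable _)).
Qed.

Let iter_shift_measurable l (A : set (borel (seqspace U))) : measurable A ->
  measurable (iter l left_shift @^-1` A : set (borel (seqspace U))).
Proof.
by move=> mA; rewrite -[X in measurable X]setTI;
  exact: measurable_iter_left_shift.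
Qed.

Let P_fin (A : set (borel (seqspace U))) : measurable A -> P A \is a fin_num.
Proof. exact: fin_num_measure. Qed.

Lemma fine_block_process (A : set (borel (seqspace U))) : measurable A ->
  fine (block_process k g A) =
  k%:R^-1 * \sum_(l < k) fine (P (iter l left_shift @^-1` A)).
Proof.
move=> mA; rewrite /block_process.
rewrite (eq_bigr (fun l : 'I_k => (fine (P (iter l left_shift @^-1` A)))%:E)).
  by rewrite sumEFin.
by move=> l _; rewrite fineK// P_fin//; exact: iter_shift_measurable.
Qed.

(** Shifting moves the average over l by one step, so it changes only two of
    its k terms. *)
Lemma block_process_shift (A : set (borel (seqspace U))) : measurable A ->
  `|fine (block_process k g (left_shift @^-1` A)) - fine (block_process k g A)|
  <= k%:R^-1.
Proof.
move=> mA.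
have mTA : measurable (left_shift @^-1` A : set (borel (seqspace U))).
  exact: (iter_shift_measurable 1 mA).
rewrite !fine_block_process// -mulrBr -sumrB.
pose f l := fine (P (iter l left_shift @^-1` A)).
have -> : \sum_(l < k) (fine (P (iter l left_shift @^-1` (left_shift @^-1` A)))
  -
      fine (P (iter l left_shift @^-1` A))) = f k - f 0%N.
  rewrite -(telescope_sumr f (leq0n k)) big_mkord; apply: eq_bigr => l _.
  by congr (fine (P _) - _); rewrite eqEsubset; split.
have f01 l : 0 <= f l <= 1.
  rewrite fine_ge0//= -lee_fin fineK; last by rewrite P_fin//;
    exact: iter_shift_measurable.
  by apply: probability_le1; exact: iter_shift_measurable.
rewrite normrM normfV normr_nat ler_piMr ?invr_ge0// ler_norml.
by have /andP[? ?] := f01 k; have /andP[? ?] := f01 0%N; apply/andP; split; lra.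
Qed.

Lemma block_process_subword l (w : seq U) : (l + size w <= k)%N ->
  P (iter l left_shift @^-1` cylinder w) = g (subword_at k l w).
Proof.
move=> lk; rewrite -(first_block (subword_at k l w)); congr (P _).
by rewrite window_subword_at.
Qed.

(** All but the last windows of length size w stay inside one block, where they
    are governed by the k-dimensional marginal. *)
Lemma block_process_marginal (V : pfinType) (phi : U -> V)
    (mu : probability (borel (seqspace V)) R)
    (a : probability (borel (blockspace V k)) R) (w : seq V) :
  stationary mu ->
  (forall A : set (borel (blockspace V k)), measurable A ->
     g (block_map phi (k := k) @^-1` A) = a A) ->
  `|fine (block_process k g (seq_map phi @^-1` cylinder w)) -
    fine (mu (cylinder w))| <=
  \sum_(i : k.-tuple V) `|fine (a [set i]) - fine (mu (cylinder i))| +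
    (size w)%:R / k%:R.
Proof.
move=> smu ga; set D := \sum_i _; set m := size w; set b := fine (mu _).
have mC : measurable (cylinder w : set (borel (seqspace V))).
  exact: cylinder_measurable.
have mphiC : measurable (seq_map phi @^-1` cylinder w : set (borel (seqspace
  U))).
  exact: of_level_measurable (seq_map_level (@cylinder_level V w)).
have k0 : 0 < k%:R :> R by rewrite ltr0n.
rewrite fine_block_process//.
set t := fun l => fine (P (iter l left_shift @^-1` (seq_map phi @^-1` cylinder
  w))).
have -> : k%:R^-1 * \sum_(l < k) t l - b = k%:R^-1 * \sum_(l < k) (t l - b).
  by rewrite sumrB sumr_const card_ord mulrBr -[b *+ k]mulr_natl mulKf// gt_eqF.
rewrite normrM normfV normr_nat mulrC ler_pdivrMr// mulrDl divfK ?gt_eqF//.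
have step l : (l < k)%N -> `|t l - b| <= D + (k < l + m)%N%:R.
  move=> lk; have [km|km] := ltnP k (l + m).
    have t01 : 0 <= t l <= 1.
      rewrite fine_ge0//= -lee_fin fineK; last by rewrite P_fin//;
        exact: iter_shift_measurable.
      by apply: probability_le1; exact: iter_shift_measurable.
    have b01 : 0 <= b <= 1.
      by rewrite fine_ge0//= -lee_fin fineK ?fin_num_measure//;
        exact: probability_le1.
    have D0 : 0 <= D by exact: sumr_ge0.
    rewrite (_ : true%:R = 1 :> R)// ler_norml.
    move: (t l) t01 b01 => s /andP[? ?] /andP[? ?].
    by apply/andP; split; lra.
  have -> : t l = fine (a (subword_at k l w)).
    rewrite -ga; last exact: block_measurable.
    rewrite /t -(first_block (block_map phi (k := k) @^-1` subword_at k l w)).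
    congr (fine (P _)).
    have := window_subword_at km; rewrite !eqEsubset => -[h1 h2].
    split=> u /= uw.
      rewrite -window_seq_map; apply: h2; move: uw; rewrite /cylinder/=.
      by congr (_ = _); apply: eq_map => i;
        rewrite !iter_left_shiftE /seq_map iter_left_shiftE.
    have := h1 (seq_map phi u); rewrite /= window_seq_map => /(_ uw).
    rewrite /cylinder/=.
    by congr (_ = _); apply: eq_map => i;
      rewrite !iter_left_shiftE /seq_map iter_left_shiftE.
  have -> : b = fine (mu (window k 0 @^-1` subword_at k l w)).
    by rewrite window_subword_at// /b -(stationary_iter smu l mC).
  rewrite block_measure1 (measure1_window _ (probability_setT mu)).
  rewrite -sumrB addr0 (le_trans (ler_norm_sum _ _ _))// /D.
  by rewrite [leRHS](bigID (mem (subword_at k l w)))/= lerDl sumr_ge0.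
apply: (le_trans (ler_norm_sum _ _ _)).
apply: (@le_trans _ _ (\sum_(l < k) (D + (k < l + m)%N%:R))).
  by apply: ler_sum => l _; exact: step.
rewrite big_split/= sumr_const card_ord -[D *+ k]mulr_natr lerD2l -natr_sum
  ler_nat.
(* at most size w windows cross the end of the block *)
suff H n : (\sum_(l < n) (k < l + m) <= n + m - k)%N.
  by rewrite (leq_trans (H k))// addKn.
elim: n => [|n IHn]; first by rewrite big_ord0.
rewrite big_ord_recr/=; move: (\sum_(i < n) _)%N IHn => S IHn.
by case: (ltnP k (n + m)) => /=; lia.
Qed.

(** A letter of the averaged process is a uniformly placed letter of one block,
    so the identity between costs is exact. *)
Lemma block_process_cost (h : U -> R) :
  \sum_(v : U) h v * fine (block_process k g (cylinder [:: v])) =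
  k%:R^-1 * \sum_(z : k.-tuple U)
    (\sum_(l < k) h (tnth z l)) * fine (g [set z]).
Proof.
have sub1 (v : U) (l : 'I_k) :
    fine (P (iter l left_shift @^-1` cylinder [:: v])) =
    \sum_(z : k.-tuple U | tnth z l == v) fine (g [set z]).
  rewrite block_process_subword ?addn1// block_measure1; apply: eq_bigl => z.
  rewrite (tnth_nth point).
  have e : take 1 (drop l z) = [:: nth point z l].
    by rewrite (drop_nth point) ?size_tuple//= take0.
  apply/idP/eqP => [/set_mem|zv]; first by rewrite /subword_at/= e => -[].
  by apply/mem_set; rewrite /subword_at/= e zv.
transitivity (\sum_(v : U) k%:R^-1 * \sum_(l < k)
    \sum_(z : k.-tuple U | tnth z l == v) h (tnth z l) * fine (g [set z])).
  apply: eq_bigr => v _; rewrite fine_block_process;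
    last exact: cylinder_measurable.
  rewrite mulrCA; congr (_ * _); rewrite mulr_sumr; apply: eq_bigr => l _.
  by rewrite sub1 mulr_sumr; apply: eq_bigr => z /eqP ->.
rewrite -mulr_sumr exchange_big/=; congr (_ * _).
under [RHS]eq_bigr do rewrite mulr_suml.
rewrite [RHS]exchange_big/=; apply: eq_bigr => l _.
by rewrite [RHS](partition_big (fun z : k.-tuple U => tnth z l) xpredT).
Qed.

End block_process_laws.

(** * Upper bound for the cost estimate *)

Section block_transport.
Context {R : realType} {X Y : pfinType}.
Implicit Types (k n : nat).

Definition block_pair k (i : k.-tuple X) (j : k.-tuple Y) : k.-tuple (X * Y) :=
  [tuple (tnth i l, tnth j l) | l < k].

Let fst_pair k i j : @block_fst X Y k (block_pair i j) = i.
Proof. by apply/eq_from_tnth => l; rewrite !tnth_mktuple. Qed.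

Let snd_pair k i j : @block_snd X Y k (block_pair i j) = j.
Proof. by apply/eq_from_tnth => l; rewrite !tnth_mktuple. Qed.

Let pairK k z : block_pair (@block_fst X Y k z) (@block_snd X Y k z) = z.
Proof.
by apply/eq_from_tnth => l; rewrite !tnth_mktuple -surjective_pairing.
Qed.

Lemma block_pmf_sum (U : pfinType) k
    (a : probability (borel (blockspace U k)) R) :
  \sum_(i : k.-tuple U) fine (a [set i]) = 1.
Proof.
transitivity (fine (a setT)); last by rewrite probability_setT.
rewrite (block_measure1 a setT).
by apply: eq_bigl => i; rewrite in_setT.
Qed.

Lemma word_pmf_sum (U : pfinType) k (mu : probability (borel (seqspace U)) R) :
  \sum_(i : k.-tuple U) fine (mu (cylinder i)) = 1.
Proof.
transitivity (fine (mu setT)); last by rewrite probability_setT.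
have := measure1_window (setT : set (k.-tuple U)) (probability_setT mu).
rewrite preimage_setT => ->.
by apply: eq_bigl => i; rewrite in_setT.
Qed.

Lemma pmf_marginal (U V : pfinType) k (p : k.-tuple U -> k.-tuple V)
    (W : probability (borel (blockspace U k)) R)
    (a : probability (borel (blockspace V k)) R) :
  (forall i,
    \sum_(z : k.-tuple U | p z == i) fine (W [set z]) = fine (a [set i])) ->
  forall A : set (k.-tuple V), W (p @^-1` A) = a A.
Proof.
move=> Wa A; rewrite -[LHS]fineK ?block_fin_num// -[RHS]fineK ?block_fin_num//.
congr (_%:E); rewrite !block_measure1.
rewrite (partition_big p (mem A)) => [|z /set_mem Az]; last exact: mem_set.
apply: eq_bigr => i /set_mem Ai; rewrite -Wa; apply: eq_bigl => z.
apply/andP/idP => [[]//|/eqP zi]; split; last exact/eqP.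
by apply/mem_set; rewrite /= zi.
Qed.

Lemma pmf_couplings k (a : probability (borel (blockspace X k)) R)
    (b : probability (borel (blockspace Y k)) R) (w : k.-tuple (X * Y) -> R) :
  pmf_coupling (@block_fst X Y k) (@block_snd X Y k)
    (fun i => fine (a [set i])) (fun j => fine (b [set j])) w ->
  exists2 W, couplings (@block_fst X Y k) (@block_snd X Y k) a b W &
    forall z, fine (W [set z]) = w z.
Proof.
move=> [w0 wa wb].
have w1 : \sum_z w z = 1.
  rewrite -(block_pmf_sum a) (partition_big (@block_fst X Y k) xpredT)//=.
  by apply: eq_bigr => i _.
have [W Ww] := pmf_probability w0 w1.
have Wwf z : fine (W [set z]) = w z by rewrite Ww.
exists W => //; split=> A _; apply: pmf_marginal => i.
  by rewrite -wa; apply: eq_bigr => z _.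
by rewrite -wb; apply: eq_bigr => z _.
Qed.

Variable c : X -> Y -> R.

Definition pair_cost k (z : k.-tuple (X * Y)) : R :=
  \sum_(l < k) c (tnth z l).1 (tnth z l).2.

Lemma coupling_costE k (W : probability (borel (blockspace (X * Y)%type k)) R) :
  coupling_cost (@block_fst X Y k) (@block_snd X Y k)
    (@block_cost R X Y c k) W =
  (\sum_z pair_cost z * fine (W [set z]))%:E.
Proof.
rewrite /coupling_cost block_integral; last by move=> z; exact: block_fin_num.
congr (_%:E); apply: eq_bigr => z _; congr (_ * _); rewrite /block_cost.
by apply: eq_bigr => l _; rewrite !tnth_mktuple.
Qed.

(** The real number underlying joining_cost. *)
Definition first_cost
    (la : probability (borel (seqspace (X * Y)%type)) R) : R :=
  \sum_(v : X * Y) c v.1 v.2 * fine (la (cylinder [:: v])).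

Lemma joining_costE (la : probability (borel (seqspace (X * Y)%type)) R) :
  joining_cost c la = (first_cost la)%:E.
Proof.
pose m1 : {measure set borel (blockspace (X * Y)%type 1) -> \bar R} :=
  measure_function_pushforward__canonical__measure_function_Measure la
    (@window_measurable (X * Y)%type 1 0).
have m1E (z : 1.-tuple (X * Y)) : m1 [set z] = la (cylinder z).
  by rewrite -window_cylinder.
transitivity (\int[m1]_z (c (thead z).1 (thead z).2)%:E)%E; first by [].
rewrite (@block_integral _ _ _ m1 (fun z => c (thead z).1 (thead z).2));
  last first.
  by move=> z; rewrite m1E fin_num_measure//; exact: cylinder_measurable.
congr (_%:E); rewrite (eq_bigr (fun z : 1.-tuple (X * Y)%type =>
  c (head point z).1 (head point z).2 * fine (la (cylinder z)))); last first.
  by move=> z _; rewrite m1E /thead (tnth_nth point) nth0.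
rewrite (@sum_tuple_rcons _ _ 0 (fun z : seq (X * Y)%type =>
  c (head point z).1 (head point z).2 * fine (la (cylinder z)))).
by rewrite (big_pred1 [tuple]) => [//|z]; apply/esym/eqP; exact: tuple0.
Qed.

Hypothesis c_ge0 : forall x y, 0 <= c x y.

(** A crude upper bound of all values of c. *)
Definition total_cost : R := \sum_(v : X * Y) c v.1 v.2.

Lemma pair_cost_bounds k (z : k.-tuple (X * Y)) :
  0 <= pair_cost z <= k%:R * total_cost.
Proof.
rewrite sumr_ge0//=; apply: (@le_trans _ _ (\sum_(l < k) total_cost)).
  apply: ler_sum => l _; rewrite /total_cost (bigD1 (tnth z l))//= lerDl.
  exact: sumr_ge0.
by rewrite sumr_const card_ord mulr_natl.
Qed.

Lemma first_cost_ge0 (la : probability (borel (seqspace (X * Y)%type)) R) :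
  0 <= first_cost la.
Proof. by apply: sumr_ge0 => v _; rewrite mulr_ge0// fine_ge0. Qed.

(** The k-marginal of a joining couples the k-marginals of mu and nu at cost k
    times the joining cost; perturbing it to the empirical marginals bounds the
    estimate from above. *)
Lemma cost_estimate_ub k n (x : seqspace X) (y : seqspace Y)
    (mu : probability (borel (seqspace X)) R)
    (nu : probability (borel (seqspace Y)) R) la :
  (0 < k)%N -> joinings mu nu la ->
  (cost_estimate c k n x y <= (first_cost la +
    total_cost * (word_dist mu k n x + word_dist nu k n y))%:E)%E.
Proof.
move=> k_gt0 [[lamu lanu] sla]; have k0 : 0 < k%:R :> R by rewrite ltr0n.
have la1 := probability_setT la.
pose w1 (z : k.-tuple (X * Y)) := fine (la (cylinder z)).
have w1P : pmf_coupling (@block_fst X Y k) (@block_snd X Y k)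
    (fun i => fine (mu (cylinder i))) (fun j => fine (nu (cylinder j))) w1.
  split=> [z|i|j]; first exact: fine_ge0.
    rewrite -lamu; last exact: cylinder_measurable.
    have <- : window k 0 @^-1` [set z : k.-tuple (X * Y) | block_fst z = i] =
        (@seq_fst X Y) @^-1` cylinder i.
      rewrite -window_cylinder eqEsubset.
      by split=> u /=; rewrite (window_seq_map fst).
    rewrite (measure1_window _ la1); apply: eq_bigl => z.
    by apply/eqP/idP => [zi|/set_mem//]; exact: mem_set.
  rewrite -lanu; last exact: cylinder_measurable.
  have <- : window k 0 @^-1` [set z : k.-tuple (X * Y) | block_snd z = j] =
      (@seq_snd X Y) @^-1` cylinder j.
    rewrite -window_cylinder eqEsubset.
    by split=> u /=; rewrite (window_seq_map snd).
  rewrite (measure1_window _ la1); apply: eq_bigl => z.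
  by apply/eqP/idP => [zi|/set_mem//]; exact: mem_set.
have w1c : \sum_z pair_cost z * w1 z = k%:R * first_cost la.
  rewrite /pair_cost; under eq_bigr do rewrite mulr_suml.
  rewrite exchange_big/= mulr_natl -[X in _ *+ X]card_ord -sumr_const.
  apply: eq_bigr => l _.
  rewrite (partition_big (fun z : k.-tuple (X * Y) => tnth z l) xpredT)//=.
  apply: eq_bigr => v _.
  rewrite (eq_bigr (fun z => c v.1 v.2 * w1 z)); last by move=> z /eqP ->.
  rewrite -mulr_sumr; congr (_ * _).
  have mv : measurable (cylinder [:: v] : set (borel (seqspace (X * Y)%type))).
    exact: cylinder_measurable.
  rewrite -(stationary_iter sla l mv).
  have <- : window k 0 @^-1` [set z : k.-tuple (X * Y) | tnth z l = v] =
      iter l left_shift @^-1` cylinder [:: v].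
    have ul (u : seqspace (X * Y)%type) :
        mkseq (iter l left_shift u) 1 = [:: u l].
      by rewrite /mkseq/= iter_left_shiftE addn0.
    rewrite eqEsubset; split=> u; rewrite /cylinder /= tnth_mktuple add0n ul.
      by move=> <-.
    by case.
  rewrite (measure1_window _ la1); apply: eq_bigl => z.
  by apply/eqP/idP => [zi|/set_mem//]; exact: mem_set.
have [||||||w wP wc] := @perturb_coupling R _ _ _ _ _ _
  (@fst_pair k) (@snd_pair k) (@pairK k) (@pair_cost k) (k%:R * total_cost)
  (fun i => fine (empirical R X k n x [set i]))
  (fun j => fine (empirical R Y k n y [set j])) _ _ w1 _ _ _ _ _ _ w1P.
- exact: pair_cost_bounds.
- by move=> i; exact: fine_ge0.
- by move=> j; exact: fine_ge0.
- exact: block_pmf_sum.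
- exact: block_pmf_sum.
- exact: word_pmf_sum.
have [W WC Ww] := pmf_couplings wP.
rewrite /cost_estimate -lee_pdivlMl ?lte_fin ?invr_gt0//.
apply: (@le_trans _ _ (coupling_cost (@block_fst X Y k) (@block_snd X Y k)
  (@block_cost R X Y c k) W)); first by apply: ereal_inf_lbound; exists W.
rewrite coupling_costE invrK -EFinM lee_fin.
under eq_bigr do rewrite Ww.
by apply: (le_trans wc); rewrite w1c -mulrA -mulrDr.
Qed.

Lemma couplings_nonempty k (a : probability (borel (blockspace X k)) R)
    (b : probability (borel (blockspace Y k)) R) :
  couplings (@block_fst X Y k) (@block_snd X Y k) a b !=set0.
Proof.
have [||||w /pmf_couplings[W WC _]] := @coupling_exists R _ _ _ _ _ _
  (@fst_pair k) (@snd_pair k) (@pairK k)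
  (fun i => fine (a [set i])) (fun j => fine (b [set j])).
- by move=> i; exact: fine_ge0.
- by move=> j; exact: fine_ge0.
- exact: block_pmf_sum.
- exact: block_pmf_sum.
by exists W.
Qed.

Lemma near_optimal_coupling k n (x : seqspace X) (y : seqspace Y) (e : R) :
  (0 < k)%N -> 0 < e -> exists2 W,
    couplings (@block_fst X Y k) (@block_snd X Y k)
      (empirical R X k n x) (empirical R Y k n y) W &
    cost_estimate c k n x y \is a fin_num /\
    k%:R^-1 * (\sum_z pair_cost z * fine (W [set z])) <=
      fine (cost_estimate c k n x y) + e.
Proof.
move=> k_gt0 e0; have k0 : 0 < k%:R :> R by rewrite ltr0n.
set T := transport_cost (@block_fst X Y k) (@block_snd X Y k)
  (@block_cost R X Y c k) (empirical R X k n x) (empirical R Y k n y).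
have Tfin : T \is a fin_num.
  rewrite ge0_fin_numE.
    have [W WC] := couplings_nonempty (empirical R X k n x) (empirical R Y k n
      y).
    apply: (@le_lt_trans _ _ (coupling_cost (@block_fst X Y k) (@block_snd X Y
      k)
      (@block_cost R X Y c k) W)); first by apply: ereal_inf_lbound; exists W.
    by rewrite coupling_costE ltry.
  apply: le_ereal_inf_tmp => _ [W WC <-];
    rewrite coupling_costE lee_fin sumr_ge0// => z _.
  by have /andP[? _] := pair_cost_bounds z; rewrite mulr_ge0// fine_ge0.
have ke0 : 0 < k%:R * e by rewrite mulr_gt0.
have [_ [W WC <-] WT] := lb_ereal_inf_adherent ke0 Tfin.
exists W => //; rewrite /cost_estimate -/T; split; first by rewrite fin_numM.
have {}WT : (coupling_cost (@block_fst X Y k) (@block_snd X Y k)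
  (@block_cost R X Y c k) W < T + (k%:R * e)%:E)%E := WT.
move: WT; rewrite coupling_costE -(fineK Tfin) -EFinD lte_fin => /ltW WT.
rewrite -EFinM/= -(ler_pM2l k0) mulrDr !mulrA !divff ?gt_eqF// !mul1r.
exact: WT.
Qed.

End block_transport.

(** * Limits of block processes *)

Lemma frequent_subsequence (Q : nat -> Prop) :
  (forall m, exists n, (m <= n)%N /\ Q n) ->
  exists s : nat -> nat, {homo s : m n / (m < n)%N} /\ forall n, Q (s n).
Proof.
move=> /choice[F FP].
pose s := fix s j := if j is j'.+1 then F (s j').+1 else F 0%N.
exists s; split; last by case=> [|n];
  [have [] := FP 0%N|have [] := FP (s n).+1].
have sS j : (s j < s j.+1)%N by have [] := FP (s j).+1.
by apply: homo_ltn sS; exact: ltn_trans.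
Qed.

Lemma increasing_cvg_oo (s : nat -> nat) :
  {homo s : m n / (m < n)%N} -> s @ \oo --> \oo.
Proof.
move=> sm; have sn n : (n <= s n)%N.
  by elim: n => // n IHn; exact: leq_ltn_trans IHn (sm _ _ (ltnSn n)).
by apply/cvgnyPge => m; exists m => // n /= mn; exact: leq_trans mn (sn n).
Qed.

Section limit_joinings.
Context {R : realType} {X Y : pfinType}.
Variable c : X -> Y -> R.
Variables (mu : probability (borel (seqspace X)) R)
  (nu : probability (borel (seqspace Y)) R).
Hypotheses (smu : stationary mu) (snu : stationary nu).
Variables (k N : nat -> nat) (x : seqspace X) (y : seqspace Y).
Variable W : forall n, probability (borel (blockspace (X * Y)%type (k n))) R.
Hypotheses (k_gt0 : forall n, (0 < k n)%N) (k_oo : k @ \oo --> \oo).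
Hypothesis W_couples : \forall n \near \oo,
  couplings (@block_fst X Y (k n)) (@block_snd X Y (k n))
    (empirical R X (k n) (N n) x) (empirical R Y (k n) (N n) y) (W n).
Hypotheses (x_good : word_dist mu (k n) (N n) x @[n --> \oo] --> 0)
  (y_good : word_dist nu (k n) (N n) y @[n --> \oo] --> 0).

Let la n : {measure set borel (seqspace (X * Y)%type) -> \bar R} :=
  block_process (k n) (W n).

Let la1 n : la n setT = 1%E.
Proof. exact: block_process_setT. Qed.

Let invk_cvg0 : (k n)%:R^-1 @[n --> \oo] --> (0 : R).
Proof.
apply/cvgrPdist_lt => e e0.
have := k_oo; move/cvgnyPge => /(_ (Num.bound e^-1)).
apply: filterS => n en; rewrite sub0r normrN ger0_norm ?invr_ge0//.
have ei : 0 <= e^-1 by rewrite invr_ge0 ltW.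
rewrite -[ltRHS]invrK ltf_pV2 ?posrE ?invr_gt0// ?ltr0n//.
by rewrite (lt_le_trans (archi_boundP ei))// ler_nat.
Qed.

(** The marginals of the block processes converge to mu and nu on cylinders and
    their defect of stationarity is at most 1/k, so any limit along a
    subsequence is a joining; since the cost of the first letter is a cylinder
    function, the costs converge too. *)
Lemma limit_joining : exists t : nat -> nat, {homo t : m n / (m < n)%N} /\
  exists2 P, joinings mu nu P &
    weak_cvg (fun n => la (t n)) P /\
    (k (t n))%:R^-1 * (\sum_z pair_cost c z * fine (W (t n) [set z]))
      @[n --> \oo] --> first_cost c P.
Proof.
have [t [tm [P laP]]] := cylinder_compactness la1.
have too := increasing_cvg_oo tm.
have P1 := probability_setT P.
have sub (u : nat -> R) (l : R) : u n @[n --> \oo] --> l -> u (t n) @[n -->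
  \oo] --> l.
  by move=> ul; exact: cvg_comp too ul.
have lat1 n : la (t n) setT = 1%E by exact: la1.
have laPl m (A : set (borel (seqspace (X * Y)%type))) : of_level m A ->
    fine (la (t n) A) @[n --> \oo] --> fine (P A).
  by move=> lA; exact: (cvg_level lat1 lA laP).
have marg (V : pfinType) (phi : X * Y -> V)
    (eta : probability (borel (seqspace V)) R)
    (a : forall n, probability (borel (blockspace V (k n))) R) :
    stationary eta ->
    (\forall n \near \oo, forall A : set (borel (blockspace V (k n))),
       measurable A -> W n (block_map phi (k := k n) @^-1` A) = a n A) ->
    \sum_(i : (k n).-tuple V) `|fine (a n [set i]) - fine (eta (cylinder i))|
      @[n --> \oo] --> 0 ->
    forall A : set (borel (seqspace V)), measurable A ->
      P (seq_map phi @^-1` A) = eta A.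
  move=> seta Wa a0.
  pose Q : {measure set borel (seqspace V) -> \bar R} :=
    measure_function_pushforward__canonical__measure_function_Measure P
      (seq_map_measurable phi).
  apply: (@eq_probability_cylinder R V Q eta) => [w|]; last first.
    by change (P setT < +oo)%E; rewrite P1 ltry.
  have mC : measurable (cylinder w : set (borel (seqspace V))).
    exact: cylinder_measurable.
  have lw := seq_map_level (phi := phi) (@cylinder_level V w).
  change (P (seq_map phi @^-1` cylinder w) = eta (cylinder w)).
  rewrite -[LHS]fineK ?fin_num_measure//; last exact: of_level_measurable lw.
  rewrite -[RHS]fineK ?fin_num_measure//; congr (_%:E).
  apply: (cvg_unique _ (laPl _ _ lw)); first exact: norm_hausdorff.
  suff laE : fine (la n (seq_map phi @^-1` cylinder w)) @[n --> \oo]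
      --> fine (eta (cylinder w)) by exact: (sub _ _ laE).
  pose E n := \sum_(i : (k n).-tuple V)
    `|fine (a n [set i]) - fine (eta (cylinder i))| + (size w)%:R * (k n)%:R^-1.
  have E0 : E n @[n --> \oo] --> 0.
    rewrite -[X in _ --> X](addr0 0); apply: cvgD => //.
    by rewrite -(mulr0 (size w)%:R); apply: cvgMr.
  apply/cvgrPdist_le => e e0; have /cvgrPdist_le/(_ _ e0) En := E0.
  apply: filterS2 Wa En => n Wn; rewrite sub0r normrN => En; rewrite distrC.
  apply: le_trans (block_process_marginal (k_gt0 n) w seta Wn) _.
  by apply: le_trans En; exact: ler_norm.
exists t; split=> //; exists P; last split.
- split; first split.
  + apply: (marg _ fst mu (fun n => empirical R X (k n) (N n) x)) => //.
    by apply: filterS W_couples => n [].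
  + apply: (marg _ snd nu (fun n => empirical R Y (k n) (N n) y)) => //.
    by apply: filterS W_couples => n [].
  + pose Q : {measure set borel (seqspace (X * Y)%type) -> \bar R} :=
      measure_function_pushforward__canonical__measure_function_Measure P
        (@measurable_left_shift (X * Y)%type).
    apply: (@eq_probability_cylinder R _ Q P) => [w|]; last first.
      by change (P setT < +oo)%E; rewrite P1 ltry.
    have mC : measurable (cylinder w : set (borel (seqspace (X * Y)%type))).
      exact: cylinder_measurable.
    have lT : of_level (size w).+1 (left_shift @^-1` cylinder w).
      move=> u v /mkseq_eqP uv; apply: cylinder_level; apply/mkseq_eqP => i iw.
      by rewrite /left_shift uv.
    change (P (left_shift @^-1` cylinder w) = P (cylinder w)).
    rewrite -[LHS]fineK ?fin_num_measure//; last exact: of_level_measurable lT.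
    rewrite -[RHS]fineK ?fin_num_measure//; congr (_%:E).
    apply: (cvg_unique _ (laPl _ _ lT)); first exact: norm_hausdorff.
    rewrite /=.
    have d0 : fine (la (t n) (left_shift @^-1` cylinder w)) -
        fine (la (t n) (cylinder w)) @[n --> \oo] --> 0.
      suff d0 : fine (la n (left_shift @^-1` cylinder w)) -
        fine (la n (cylinder w)) @[n --> \oo] --> 0 by exact: (sub _ _ d0).
      apply/cvgrPdist_le => e e0; have /cvgrPdist_le/(_ _ e0) := invk_cvg0.
      apply: filterS => n; rewrite !sub0r !normrN => ne.
      apply: le_trans (block_process_shift (W n) mC) _.
      by apply: le_trans ne; exact: ler_norm.
    have -> : (fun n => fine (la (t n) (left_shift @^-1` cylinder w))) =
        (fun n => (fine (la (t n) (left_shift @^-1` cylinder w)) -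
          fine (la (t n) (cylinder w))) + fine (la (t n) (cylinder w))).
      by apply/funext => n; rewrite subrK.
    by rewrite -[fine (P (cylinder w))]add0r; exact: cvgD.
- exact: weak_cvg_cylinders.
- rewrite /first_cost.
  under eq_fun do rewrite -(block_process_cost (k_gt0 _) (W _) (fun v => c v.1
    v.2)).
  apply: cvg_big => [|v _]; first exact: add_continuous.
  by apply: cvgMr; exact: laP.
Qed.

End limit_joinings.

(** * Consistency of the estimators *)

Local Open Scope ereal_scope.

Section consistency.
Context {R : realType} {X Y : pfinType}.
Variable c : X -> Y -> R.
Hypothesis c_ge0 : forall x y, (0 <= c x y)%R.
Variables (mu : probability (borel (seqspace X)) R)
  (nu : probability (borel (seqspace Y)) R).
Hypotheses (smu : stationary mu) (snu : stationary nu).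
Variables (k : nat -> nat) (x : seqspace X) (y : seqspace Y).
Hypotheses (k_gt0 : forall n, (0 < k n)%N) (k_oo : k @ \oo --> \oo).
Hypotheses (x_good : (word_dist mu (k n) n x @[n --> \oo] --> 0)%R)
  (y_good : (word_dist nu (k n) n y @[n --> \oo] --> 0)%R).

Let CE n := cost_estimate c (k n) n x y.
Let S := optimal_joining_cost c mu nu.

Let couples n W := couplings (@block_fst X Y (k n)) (@block_snd X Y (k n))
  (empirical R X (k n) n x) (empirical R Y (k n) n y) W.

Let block_mean n
    (W : probability (borel (blockspace (X * Y)%type (k n))) R) : R :=
  ((k n)%:R^-1 * (\sum_z pair_cost c z * fine (W [set z])))%R.

Lemma subsequence_joining (s : nat -> nat)
    (W : forall n, probability (borel (blockspace (X * Y)%type (k n))) R) :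
  {homo s : m n / (m < n)%N} ->
  (forall n, (1 <= n)%N -> couples (W n)) ->
  exists t : nat -> nat, {homo t : m n / (m < n)%N} /\
    exists2 P, joinings mu nu P &
      weak_cvg (fun n => block_process (k (s (t n))) (W (s (t n)))) P /\
      (block_mean (W (s (t n))) @[n --> \oo] --> first_cost c P)%R.
Proof.
move=> sm WC; have soo := increasing_cvg_oo sm.
apply: (@limit_joining R X Y c mu nu smu snu (fun n => k (s n)) s x y
  (fun n => W (s n))) => //.
- exact: cvg_comp soo k_oo.
- exists 1%N => // n /= n1; apply: WC.
  exact: leq_ltn_trans (leq0n (s 0%N)) (sm _ _ n1).
- exact: (cvg_comp _ _ soo x_good).
- exact: (cvg_comp _ _ soo y_good).
Qed.

Let S_le (P : probability (borel (seqspace (X * Y)%type)) R) :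
  joinings mu nu P -> S <= (first_cost c P)%:E.
Proof.
by move=> JP; rewrite -joining_costE; apply: ereal_inf_lbound; exists P.
Qed.

(** Limits of block processes built on arbitrary couplings provide a joining,
    so the infimum is not over the empty set. *)
Lemma optimal_joining_cost_fin_num : S \is a fin_num.
Proof.
have W0 n := couplings_nonempty (empirical R X (k n) n x) (empirical R Y (k n)
  n y).
have [t [_ [P JP _]]] := @subsequence_joining id (fun n => sval (cid (W0 n)))
  (fun _ _ => id) (fun n _ => svalP (cid (W0 n))).
rewrite ge0_fin_numE; first exact: le_lt_trans (S_le JP) (ltry _).
apply: le_ereal_inf_tmp => _ [la _ <-].
by rewrite joining_costE lee_fin first_cost_ge0.
Qed.

Let CE_fin n : CE n \is a fin_num.
Proof.
by have [W _ []] := near_optimal_coupling c_ge0 n x y (k_gt0 n) (@ltr01 R).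
Qed.

(** Compactness reduces convergence to subsequences. Near-optimal couplings
    have a limiting joining, whose cost is at least S, so the estimates are not
    asymptotically below S; cost_estimate_ub with a near-optimal joining bounds
    them from above. *)
Lemma cost_estimate_cvg : CE n @[n --> \oo] --> S.
Proof.
have Sfin := optimal_joining_cost_fin_num.
rewrite -(fineK Sfin); apply/fine_cvgP; split; first exact: nearW.
set sg := fine S; apply/cvgrPdist_lt => e e0; apply: contrapT => notcvg.
have e3 : (0 < e / 3)%R by rewrite divr_gt0.
have [s [sm se]] : exists s : nat -> nat, {homo s : m n / (m < n)%N} /\
    forall n, (e <= `|sg - fine (CE (s n))|)%R.
  apply: (frequent_subsequence
    (Q := fun n => (e <= `|sg - fine (CE n)|)%R)) => m; apply: contrapT => nom;
      apply: notcvg.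
  exists m => // n /= mn; rewrite ltNge; apply/negP => en; apply: nom.
  by exists n.
have i0 n : (0 < n.+1%:R^-1 :> R)%R by rewrite invr_gt0.
have WP n : exists W : probability (borel (blockspace (X * Y)%type (k n))) R,
    couples W /\ (block_mean W <= fine (CE n) + n.+1%:R^-1)%R.
  by have [W WC [_ Wle]] := near_optimal_coupling c_ge0 n x y (k_gt0 n) (i0 n);
    exists W.
pose W n := sval (cid (WP n)).
have WC n : couples (W n) by rewrite /W; case: cid => ? [].
have Wle n : (block_mean (W n) <= fine (CE n) + n.+1%:R^-1)%R.
  by rewrite /W; case: cid => ? [].
have [t [tm [P JP [_ cP]]]] := subsequence_joining sm (fun n _ => WC n).
have sP : (sg <= first_cost c P)%R by rewrite -lee_fin fineK// S_le.
have [_ [la Jla <-]] := lb_ereal_inf_adherent e3 Sfin.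
rewrite joining_costE -[ereal_inf _]/S -(fineK Sfin) -EFinD lte_fin -/sg => las.
have stoo := cvg_comp _ _ (increasing_cvg_oo tm) (increasing_cvg_oo sm).
have D0 : (word_dist mu (k n) n x + word_dist nu (k n) n y
    @[n --> \oo] --> 0 + 0)%R by exact: cvgD.
rewrite addr0 in D0.
have err : (total_cost c * (word_dist mu (k n) n x + word_dist nu (k n) n y)
    @[n --> \oo] --> total_cost c * 0)%R by exact: cvgMr.
rewrite mulr0 in err.
have nerr : \forall n \near \oo,
    (total_cost c * (word_dist mu (k n) n x + word_dist nu (k n) n y) < e /
      3)%R.
  move/cvgrPdist_lt : err => /(_ _ e3); apply: filterS => n.
  by rewrite sub0r normrN; apply: le_lt_trans; exact: ler_norm.
have ninv : \forall n \near \oo, (n.+1%:R^-1 < e / 3 :> R)%R.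
  move/cvgrPdist_lt : (@cvg_harmonic R) => /(_ _ e3); apply: filterS => n.
  by rewrite sub0r normrN; apply: le_lt_trans; exact: ler_norm.
have [n1 _ H1] := stoo _ nerr.
have [n2 _ H2] := stoo _ ninv.
move/cvgrPdist_lt : cP => /(_ _ e3)[n3 _ H3].
pose n := maxn n1 (maxn n2 n3).
have /= h1 := H1 n (leq_maxl _ _).
have /= h2 := H2 n (leq_trans (leq_maxl _ _) (leq_maxr _ _)).
have /= h3 := H3 n (leq_trans (leq_maxr _ _) (leq_maxr _ _)).
have h4 := Wle (s (t n)).
have h5 := se (t n).
have h6 : CE (s (t n)) <= _ := cost_estimate_ub c_ge0 (s (t n)) x y (k_gt0 (s
  (t n))) Jla.
move: h6; rewrite -(fineK (CE_fin (s (t n)))) lee_fin => h6.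
move: h3; rewrite ltr_distl => /andP[h3 h3'].
have {h3}h3' : (first_cost c P < block_mean (W (s (t n))) + e / 3)%R := h3'.
have {}h2 : ((s (t n)).+1%:R^-1 < e / 3 :> R)%R := h2.
have {}h4 := le_lt_trans h4 (ler_ltD (lexx _) h2).
have hlo : (sg - e < fine (CE (s (t n))))%R by clear -sP h3' h4 e0; lra.
have {}h1 : (total_cost c * (word_dist mu (k (s (t n))) (s (t n)) x +
  word_dist nu (k (s (t n))) (s (t n)) y) < e / 3)%R := h1.
have {}las : (first_cost c la < sg + e / 3)%R := las.
have {}h6 := le_lt_trans h6 (ltr_leD las (ltW h1)).
have hhi : (fine (CE (s (t n))) < sg + e)%R by clear -h6 e0; lra.
by move: h5; rewrite leNgt ltr_distl => /negP; apply; apply/andP; split; lra.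
Qed.

(** For optimal couplings the block processes have exactly the estimated cost,
    so every limiting joining costs S. *)
Lemma block_process_cvg_optimal
    (pi : forall n, probability (borel (blockspace (X * Y)%type (k n))) R) :
  (forall n, (1 <= n)%N -> optimal_block_couplings c (k n) n x y (pi n)) ->
  weak_cvg_set (fun n => block_process (k n) (pi n)) (optimal_joinings c mu nu).
Proof.
move=> pio s sm.
have [|t [tm [P JP [wP cP]]]] := @subsequence_joining s pi sm.
  by move=> n n1; have [] := pio n n1.
exists t; split => //; exists P => //; split => //.
rewrite joining_costE -/S -(fineK optimal_joining_cost_fin_num); congr (_%:E).
have /fine_cvgP[_ cS] : CE n @[n --> \oo] --> (fine S)%:E.
  by rewrite fineK ?optimal_joining_cost_fin_num//; exact: cost_estimate_cvg.
have stoo := cvg_comp _ _ (increasing_cvg_oo tm) (increasing_cvg_oo sm).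
have CE_mean n : (1 <= n)%N -> fine (CE n) = block_mean (pi n).
  move=> n1; have [_ pin] := pio n n1.
  by rewrite /CE /cost_estimate -pin coupling_costE -EFinM.
have cS' : (block_mean (pi (s (t n))) @[n --> \oo] --> fine S)%R.
  have {}cS : (fine (CE (s (t n))) @[n --> \oo] --> fine S)%R.
    exact: (cvg_comp _ _ stoo cS).
  apply: (cvg_trans _ cS); apply: near_eq_cvg; exists 1%N => // n /= n1.
  rewrite CE_mean// (leq_ltn_trans (leq0n (s (t 0%N))))//.
  by apply: sm; exact: tm.
by apply: (cvg_unique _ cP cS'); exact: norm_hausdorff.
Qed.

End consistency.

Theorem theorem3 (R : realType) (X Y : pfinType) (c : X -> Y -> R)
    (c_ge0 : forall x y, (0 <= c x y)%R)
    (mu : probability (borel (seqspace X)) R)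
    (nu : probability (borel (seqspace Y)) R)
    (mu_stationary : stationary mu) (nu_stationary : stationary nu)
    (mu_ergodic : ergodic mu) (nu_ergodic : ergodic nu) :
  exists k : nat -> nat,
    [/\ forall n, (1 <= n)%N -> (1 <= k n <= n)%N,
        k @ \oo --> \oo &
        exists (A : set (borel (seqspace X))) (B : set (borel (seqspace Y))),
          [/\ measurable A /\ mu A = 1,
              measurable B /\ nu B = 1 &
              forall (x : seqspace X) (y : seqspace Y), A x -> B y ->
                (cost_estimate c (k n) n x y @[n --> \oo]
                   --> optimal_joining_cost c mu nu) /\
                (forall pi : forall n,
                     probability (borel (blockspace (X * Y)%type (k n))) R,
                   (forall n, (1 <= n)%N ->
                      optimal_block_couplings c (k n) n x y (pi n)) ->
                   weak_cvg_set (fun n => block_process (k n) (pi n))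
                     (optimal_joinings c mu nu))]].
Proof.
have [k [A [B [k1 kn koo [mA A1 mB B1] [AP BP]]]]] :=
  good_block_lengths mu_stationary nu_stationary mu_ergodic nu_ergodic.
exists k; split=> //; first by move=> n n1; rewrite k1 kn.
exists A, B; split=> // x y Ax By; split.
  exact: (cost_estimate_cvg c_ge0 mu_stationary nu_stationary k1 koo
    (AP _ Ax) (BP _ By)).
exact: (block_process_cvg_optimal c_ge0 mu_stationary nu_stationary k1 koo
  (AP _ Ax) (BP _ By)).
Qed.
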